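(* If $X$ is an a.s. non-empty random closed set in $\mathfrak{X}$ with $\mathcal{L}^{1_{\mathcal{H}}}(X,\mathcal{F})\neq\emptyset$ (so that $\mathbf{E}^g(X|\mathcal{H})$ is defined), then $$\mathbf{m}(X|\mathcal{H})\subset\mathbf{E}^g(X|\mathcal{H})\subset\mathbf{M}(X|\mathcal{H})\quad\text{a.s.}$$
   Context: $\mathfrak{X}$ is a separable real Banach space with Borel $\sigma$-algebra $\mathcal{B}(\mathfrak{X})$; $(\Omega,\mathcal{F},\mathbf{P})$ is a complete probability space and $\mathcal{H}\subset\mathcal{F}$ is a sub-$\sigma$-algebra. An $\mathcal{H}$-measurable random set is a set-valued function $\omega\mapsto X(\omega)\subset\mathfrak{X}$ (empty values allowed) whose graph belongs to $\mathcal{H}\otimes\mathcal{B}(\mathfrak{X})$; ''random set'' means $\mathcal{F}$-measurable; it is closed (convex) if its values are so for almost all $\omega$. For $\mathcal{G}\subset\mathcal{F}$, $\mathcal{L}^0(X,\mathcal{G})$ is the family of $\mathcal{G}$-measurable random elements $\xi$ with $\xi\in X$ a.s. The conditional core $\mathbf{m}(X|\mathcal{H})$ is the largest (with respect to a.s. inclusion) $\mathcal{H}$-measurable random set a.s. contained in $X$; it exists and is closed for random closed $X$, and may have empty values. The conditional convex hull $\mathbf{M}(X|\mathcal{H})$ is the smallest (with respect to a.s. inclusion) $\mathcal{H}$-measurable random convex closed set a.s. containing $X$; it exists for every random set. A random element $\xi\in\mathcal{L}^0(\mathfrak{X},\mathcal{F})$ admits a generalised conditional expectation if there is a countable $\mathcal{H}$-measurable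 partition $\{A_i,i\geq1\}$ of $\Omega$ such that $\xi\mathbf{1}_{A_i}$ is integrable for all $i$; then $\mathbf{E}^g(\xi|\mathcal{H})=\sum_{i}\mathbf{E}(\xi\mathbf{1}_{A_i}|\mathcal{H})\mathbf{1}_{A_i}$. $\mathcal{L}^{1_{\mathcal{H}}}(X,\mathcal{F})$ is the family of $\xi\in\mathcal{L}^0(X,\mathcal{F})$ admitting a generalised conditional expectation. If it is non-empty, $\mathbf{E}^g(X|\mathcal{H})$ is the (a.s. unique) $\mathcal{H}$-measurable random closed set such that $\mathcal{L}^0(\mathbf{E}^g(X|\mathcal{H}),\mathcal{H})$ is the closure in probability of $\{\mathbf{E}^g(\xi|\mathcal{H}):\ \xi\in\mathcal{L}^{1_{\mathcal{H}}}(X,\mathcal{F})\}$. *)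

(* Defs.v *)
From HB Require Import structures.
From mathcomp Require Import all_boot all_order all_algebra.
From mathcomp Require Import all_classical all_reals all_analysis.

Set Implicit Arguments.
Unset Strict Implicit.
Unset Printing Implicit Defensive.
Import Order.TTheory GRing.Theory Num.Theory.
Import numFieldNormedType.Exports.
Local Open Scope classical_set_scope.
Local Open Scope ring_scope.

Definition separable_space (T : topologicalType) : Prop :=
  exists2 D : set T, countable D & dense D.

(* Borel sigma-algebra of T, carried by a copy of T. *)
Notation borelType T := (g_sigma_algebraType (@open T)).

Section RandomSets.
Context {d : measure_display} {W : measurableType d} {R : realType}
  {V : completeNormedModType R}.
Variable P : probability W R.

Implicit Types (G H : set (set W)) (X Y : W -> set V) (xi eta : W -> V).

Definition sub_sigma_field H : Prop :=
  sigma_algebra [set: W] H /\ H `<=` measurable.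

(* A sigma-algebra G on W is passed as a set of sets; since G is one,
   the measurable sets of g_sigma_algebraType G are exactly those in G. *)
Definition random_element G xi : Prop :=
  measurable_fun [set: g_sigma_algebraType G]
    (xi : g_sigma_algebraType G -> borelType V).

Definition random_set G X : Prop :=
  measurable ([set p | X p.1 p.2] :
    set (g_sigma_algebraType G * borelType V)).

Definition as_sub X Y : Prop := {ae P, forall w, X w `<=` Y w}.

Definition as_closed X : Prop := {ae P, forall w, closed (X w)}.

Definition as_convex X : Prop := {ae P, forall w, convex_set (X w)}.

Definition as_nonempty X : Prop := {ae P, forall w, X w !=set0}.

Definition L0 X G : set (W -> V) :=
  [set xi | random_element G xi /\ {ae P, forall w, X w (xi w)}].

(* Conditional core and conditional convex hull are determined up to a.s.
   equality only, so they are given as predicates on their versions. *)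
Definition is_cond_core X H (m : W -> set V) : Prop :=
  [/\ random_set H m, as_sub m X &
      forall Y, random_set H Y -> as_sub Y X -> as_sub Y m].

Definition is_cond_hull X H (M : W -> set V) : Prop :=
  [/\ random_set H M, as_closed M, as_convex M, as_sub X M &
      forall Y, random_set H Y -> as_closed Y -> as_convex Y ->
        as_sub X Y -> as_sub M Y].

Definition simple_element (s : W -> V) : Prop :=
  random_element measurable s /\ finite_set (range s).

Definition simple_integral (A : set W) (s : W -> V) : V :=
  \sum_(x \in [set: V]) fine (P (A `&` s @^-1` [set x])) *: x.

Definition is_bochner_integral (A : set W) xi (v : V) : Prop :=
  exists s : nat -> W -> V,
    [/\ forall n, simple_element (s n),
        (\int[P]_(w in A) `|xi w - s n w|%:E)%E @[n --> \oo] --> 0%E &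
        simple_integral A (s n) @[n --> \oo] --> v].

(* V being separable, Borel measurability is strong measurability. *)
Definition bochner_integrable xi : Prop :=
  random_element measurable xi /\
  P.-integrable [set: W] (fun w => `|xi w|%:E).

Definition is_cond_expectation H xi eta : Prop :=
  [/\ bochner_integrable xi, bochner_integrable eta, random_element H eta &
      forall A, H A ->
        exists2 v, is_bochner_integral A xi v & is_bochner_integral A eta v].

(* Empty blocks are allowed, so that finite partitions are included. *)
Definition countable_partition H (A : nat -> set W) : Prop :=
  [/\ forall i, H (A i), trivIset [set: nat] A & \bigcup_i A i = [set: W]].

Definition restr (A : set W) xi : W -> V := fun w => \1_A w *: xi w.

Definition admits_gen_cond_expectation H xi : Prop :=
  random_element measurable xi /\
  exists2 A, countable_partition H A &
    forall i, bochner_integrable (restr (A i) xi).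

(* The blocks A i are disjoint, so at each
   point at most one term of the series is nonzero. *)
Definition is_gen_cond_expectation H xi eta : Prop :=
  random_element H eta /\
  exists (A : nat -> set W) (e : nat -> W -> V),
    [/\ countable_partition H A,
        forall i, is_cond_expectation H (restr (A i) xi) (e i) &
        {ae P, forall w,
          eta w = limn (series (fun i => restr (A i) (e i) w))}].

Definition L1H X H : set (W -> V) :=
  [set xi | L0 X measurable xi /\ admits_gen_cond_expectation H xi].

(* Convergence in probability is metrizable, so sequences suffice. *)
Definition closure_in_probability G (S : set (W -> V)) : set (W -> V) :=
  [set eta | random_element G eta /\
    exists z : nat -> W -> V, (forall n, S (z n)) /\
      forall eps : R, 0 < eps ->
        P [set w | eps <= `|z n w - eta w|] @[n --> \oo] --> 0%E].

Definition gen_cond_expectations X H : set (W -> V) :=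
  [set eta | exists2 xi, L1H X H xi & is_gen_cond_expectation H xi eta].

Definition is_set_gen_cond_expectation X H (E : W -> set V) : Prop :=
  [/\ random_set H E, as_closed E &
      L0 E H = closure_in_probability H (gen_cond_expectations X H)].

End RandomSets.

(* Main.v *)
Require Import Defs.
From HB Require Import structures.
From mathcomp Require Import all_boot all_order all_algebra.
From mathcomp Require Import all_classical all_reals all_analysis.
From mathcomp Require Import measurable_realfun.
From mathcomp Require Import ring lra.
Set Implicit Arguments.
Unset Strict Implicit.
Unset Printing Implicit Defensive.
Import Order.TTheory GRing.Theory Num.Theory.
Import numFieldNormedType.Exports.
Local Open Scope classical_set_scope.
Local Open Scope ring_scope.

(** Both inclusions reduce to a measurable selection theorem.  A set D in the
    product of H with the Borel sets of V admits an H-measurable zeta defined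
    on some A in H, with zeta w in D w on A and D w empty for almost every w
    outside A ([random_set_selection]).

    For m in E, apply this to the points of m that are not in E.  The element
    equal to zeta on A and to some fixed xi0 of L1H off A lies in X, and its
    generalised conditional expectation equals zeta on A, because zeta is
    already H-measurable ([gen_cond_expectation_glue]).  So zeta w is in E w
    almost surely on A, and A is null.  That the integrable pieces of xi0 have
    conditional expectations at all is a theorem for V-valued elements
    ([cond_expectation_exists]): an integrable f is an absolutely convergent
    sum of atoms y_k times the indicator of B_k ([atomic_decomposition]), and
    the sum of the P(B_k | H) y_k, with P(B_k | H) a Radon-Nikodym density, is
    its conditional expectation.

    For E in M, select zeta among the points of E that are not in M and extend
    it to an element of L0 E H.  It is a limit in probability of generalised
    conditional expectations of elements of X.  These lie in M
    ([cond_expectation_in_convex]), and M is closed, so zeta is in M almost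
    surely on A, and A is null.

    That conditional expectations of elements of M stay in the closed convex M
    is shown without duality.  If e = E(f | H) kept a distance from M on a set
    of positive probability, that set would contain a piece A in H, of positive
    probability, on which e is nearly a constant c and the balls around
    q_0, ..., q_(N-1) of a dense sequence that meet M w are the same for all w.
    The mean over A of f, which is the mean of e, is close to c on the one hand,
    and on the other to a convex combination of those q_k, hence of points
    of M w ([cond_expectation_near]).

    The selection theorem rests on the projection argument of capacity theory.
    A set of the product sigma-algebra comes from the Souslin operation applied
    to rectangles with closed sides ([souslin_measurable]).  Bounding the
    branches one coordinate after the other, at an arbitrarily small cost in
    outer measure, makes the tree of branches finitely branching; then the
    projection becomes measurable, and a leftmost branch, whose closed sets
    shrink to a point, gives the selection ([selection_outer_gt]). *)

(** * Borel functions into a separable normed space *)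

Lemma exists_invS_lt (R : realType) (e : R) :
  0 < e -> exists n, n.+1%:R^-1 < e.
Proof.
by move=> e0; have /filter_ex[n] := near_infty_natSinv_lt (PosNum e0); exists n.
Qed.

Lemma measurable_lt_set (d : measure_display) (T : measurableType d)
    (R : realType) (f g : T -> R) :
  measurable_fun setT f -> measurable_fun setT g ->
  measurable [set w | f w < g w].
Proof.
move=> mf mg; have := measurable_fun_ltr mf mg measurableT (Y := [set true]) I.
by rewrite setTI; congr measurable; apply/seteqP; split=> w /=.
Qed.

Local Notation borel_fun f :=
  (measurable_fun [set: _] (f : _ -> borelType _)).

Lemma borel_fun_open (d : measure_display) (T : measurableType d)
    (R : realType) (V : normedModType R) (f : T -> V) :
  (forall U, open U -> measurable (f @^-1` U)) -> borel_fun f.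
Proof.
move=> fU; apply: (@measurability _ _ _ (borelType V) _ _ (@open V)) => //.
by move=> _ [U oU <-]; rewrite setTI; exact: fU.
Qed.

Lemma dense_sequence (R : realType) (V : normedModType R) :
  separable_space V ->
  exists q : nat -> V, forall x (e : R), 0 < e -> exists n, `|x - q n| < e.
Proof.
move=> [D cD dD].
have [d0 Dd0] : D !=set0.
  by have [x [_ Dx]] := dD setT (ex_intro _ 0 I) openT; exists x.
have /pfcard_geP[D0|[q]] := cD; first by rewrite D0 in Dd0.
exists q => x e e0.
have [y []] := dD (ball x e) (ex_intro _ x (ballxx x e0)) (ball_open x e).
rewrite -ball_normE /= => xy Dy.
have /= [n _ qn] := @surj _ _ _ _ q y Dy.
by exists n; rewrite qn.
Qed.

(** A separable space has a countable base of balls, so Borel measurability can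
    be tested on distances to fixed points.  Limits, sums and gluings of V-valued
    functions are thereby reduced to real-valued ones. *)
Lemma borel_funP (d : measure_display) (T : measurableType d) (R : realType)
    (V : normedModType R) (f : T -> V) :
  separable_space V ->
  borel_fun f <-> forall x : V, measurable_fun [set: T] (fun w => `|f w - x|).
Proof.
move=> /dense_sequence[q dq]; split=> [mf x|mf].
  apply: (measurability _ (RGenOInfty.measurableE R)) => _ [_ [a ->] <-].
  rewrite setTI (_ : _ @^-1` _ = f @^-1` [set y : V | a < `|y - x|]).
    rewrite -[X in measurable X]setTI; apply: mf => //.
    apply: sub_sigma_algebra.
    apply: (@open_comp _ _ (fun y : V => `|y - x|) [set r : R | a < r]).
      by move=> y _; apply: cvg_norm; apply: cvgB; [exact: cvg_id|exact: cvg_cst].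
    exact: open_gt.
  by apply/seteqP; split=> w; rewrite /= in_itv/= andbT.
apply: borel_fun_open => U oU.
pose K := [set p : nat * nat | ball (q p.1) p.2.+1%:R^-1 `<=` U].
rewrite (_ : f @^-1` U = \bigcup_p
    [set w | K p /\ `|f w - q p.1| < p.2.+1%:R^-1]).
  apply: countable_bigcupT_measurable => // p.
  have [Kp|nKp] := pselect (K p); last first.
    by rewrite (_ : [set _ | _] = set0)// -subset0 => w [].
  rewrite (_ : [set _ | _] = [set w | `|f w - q p.1| < p.2.+1%:R^-1]); last first.
    by apply/seteqP; split=> w /=; [case|].
  by apply: measurable_lt_set => //; exact: measurable_cst.
apply/seteqP; split=> [w Ufw|w [p _ /= [Kp fp]]]; last first.
  by apply: Kp; rewrite -ball_normE /= distrC.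
move: oU; rewrite openE => /(_ _ Ufw) /nbhs_ballP[e /= e0 eU].
have [n ne] := exists_invS_lt (divr_gt0 e0 (ltr0Sn R 1)).
have [k fk] := dq (f w) n.+1%:R^-1 ltac:(by rewrite invr_gt0).
exists (k, n) => //=; split=> // y; rewrite -ball_normE /= => yk; apply: eU.
rewrite -ball_normE /= -(subrKA (q k)).
apply: le_lt_trans (ler_normD _ _) _; rewrite [e]splitr.
by apply: ltrD; apply: lt_trans ne.
Qed.

Section BorelFunctions.
Context {d : measure_display} {T : measurableType d} {R : realType}
  {V : normedModType R}.
Hypothesis sepV : separable_space V.

Lemma measurable_fun_glue d' (T' : measurableType d') (I : countType)
    (k : T -> I) (f : I -> T -> T') :
  (forall i, measurable (k @^-1` [set i])) ->
  (forall i, measurable_fun setT (f i)) ->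
  measurable_fun setT (fun w => f (k w) w).
Proof.
move=> mk mf _ B mB; rewrite setTI.
rewrite (_ : _ @^-1` B = \bigcup_i (k @^-1` [set i] `&` f i @^-1` B)).
  apply: countable_bigcupT_measurable => [|i]; first exact: countableP.
  apply: measurableI => //.
  by rewrite -[X in measurable X]setTI; apply: mf.
apply/seteqP; split=> [w /= Bw|w [i _ [/= <-]]//].
by exists (k w).
Qed.

Lemma measurable_fun_if_set d' (T' : measurableType d') (A : set T)
    (f g : T -> T') :
  measurable A -> measurable_fun setT f -> measurable_fun setT g ->
  measurable_fun setT (fun w => if `[< A w >] then f w else g w).
Proof.
move=> mA mf mg.
apply: (measurable_fun_glue (k := fun w => `[< A w >])
  (f := fun (b : bool) w => if b then f w else g w)) => [[]|[]//].
  by rewrite (_ : _ @^-1` _ = A)//; apply/seteqP; split=> w /=; move/asboolP.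
rewrite (_ : _ @^-1` _ = ~` A); first exact: measurableC.
by apply/seteqP; split=> w /=; [move/asboolPn|move=> ?; apply/asboolPn].
Qed.

Lemma borel_fun_preimage (f : T -> V) (B : set (borelType V)) :
  borel_fun f -> measurable B -> measurable (f @^-1` B).
Proof. by move=> mf mB; rewrite -[X in measurable X]setTI; apply: mf. Qed.

Lemma borel_fun_cvg (h : nat -> T -> V) (f : T -> V) :
  (forall n, borel_fun (h n)) ->
  (forall w, h n w @[n --> \oo] --> f w) -> borel_fun f.
Proof.
move=> mh hf; apply/(borel_funP _ sepV) => x.
apply: (@measurable_realfun.measurable_fun_cvg _ _ _ _ (fun n w => `|h n w - x|)).
  by move=> n; exact: ((borel_funP _ sepV).1 (mh n)).
move=> w _; apply: cvg_norm; apply: cvgB; [exact: hf|exact: cvg_cst].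
Qed.

Lemma borel_fun_comp (V' : normedModType R) (f : T -> V) (h : V -> V') :
  borel_fun f -> continuous h -> borel_fun (h \o f).
Proof.
move=> mf ch; apply: borel_fun_open => U oU; rewrite comp_preimage.
apply: borel_fun_preimage => //.
apply: sub_sigma_algebra; apply: open_comp => // y _; exact: ch.
Qed.

Lemma borel_fun_scale (g : T -> R) (y : V) :
  measurable_fun setT g -> borel_fun (fun w => g w *: y).
Proof.
move=> mg; apply: borel_fun_open => U oU.
rewrite (_ : _ @^-1` U = g @^-1` [set r | U (r *: y)])//.
rewrite -[X in measurable X]setTI; apply: mg => //; apply: open_measurable.
apply: (@open_comp _ _ (fun r : R => r *: y)) => // r _.
by apply: cvgZr_tmp; exact: cvg_id.
Qed.

(** The product of two copies of V is never needed: the triangle inequality is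
    nearly an equality at points of a dense sequence close to g w. *)
Lemma measurable_fun_dist (f g : T -> V) :
  borel_fun f -> borel_fun g ->
  measurable_fun setT (fun w => `|f w - g w|).
Proof.
move=> mf mg; have [q dq] := dense_sequence sepV.
pose F n w := `|f w - q n| + `|g w - q n|.
have mF n : measurable_fun setT (F n).
  by apply: measurable_funD; [exact: ((borel_funP _ sepV).1 mf)|
    exact: ((borel_funP _ sepV).1 mg)].
apply: (measurability _ (RGenInftyO.measurableE R)) => _ [_ [a ->] <-].
rewrite setTI.
rewrite (_ : _ @^-1` _ = \bigcup_n [set w | F n w < a]).
  apply: bigcupT_measurable => n.
  by apply: measurable_lt_set => //; exact: measurable_cst.
apply/seteqP; split=> w; rewrite /= in_itv/=.
  move=> fga; have [n gn] := dq (g w) ((a - `|f w - g w|) / 2) ltac:(lra).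
  exists n => //; rewrite /F/=.
  have := ler_normD (f w - g w) (g w - q n); rewrite subrKA; lra.
move=> [n _]; rewrite /F/=; apply: le_lt_trans.
by rewrite -(subrKA (q n)) [X in _ <= _ + X]distrC ler_normD.
Qed.

Lemma borel_funD (f g : T -> V) :
  borel_fun f -> borel_fun g -> borel_fun (fun w => f w + g w).
Proof.
move=> mf mg; apply/(borel_funP _ sepV) => x.
have mh : borel_fun ((fun y => x - y) \o g).
  apply: borel_fun_comp => // y; apply: cvgB; [exact: cvg_cst|exact: cvg_id].
have := measurable_fun_dist mf mh.
by apply: eq_measurable_fun => w _ /=; rewrite opprB addrA.
Qed.

Lemma borel_fun_norm (f : T -> V) :
  borel_fun f -> measurable_fun setT (fun w => `|f w|).
Proof.
move=> /(borel_funP _ sepV)/(_ 0).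
by apply: eq_measurable_fun => w _; rewrite subr0.
Qed.

Lemma borel_fun_cst (y : V) : borel_fun (fun _ : T => y).
Proof. exact: measurable_cst. Qed.

Lemma borel_fun_sum (n : nat) (f : nat -> T -> V) :
  (forall k, borel_fun (f k)) -> borel_fun (fun w => \sum_(k < n) f k w).
Proof.
move=> mf; elim: n => [|n IH].
  by under eq_fun do rewrite big_ord0; exact: borel_fun_cst.
by under eq_fun do rewrite big_ord_recr/=; exact: borel_funD.
Qed.

End BorelFunctions.

(** * Souslin representation of product-measurable sets *)

(** The coding 2^i (2n+1) - 1 of pairs, used because it is increasing in n: an
    entry of the i-th coded sequence is reached only after all the earlier
    entries of that sequence. *)
Definition pair_code (i n : nat) : nat := (2 ^ i * n.*2.+1).-1.
Definition pair_row (N : nat) : nat := logn 2 N.+1.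
Definition pair_col (N : nat) : nat := (N.+1 %/ 2 ^ pair_row N)./2.

Lemma pair_codeS i n : (pair_code i n).+1 = (2 ^ i * n.*2.+1)%N.
Proof. by rewrite prednK// muln_gt0 expn_gt0. Qed.

Lemma pair_rowK i n : pair_row (pair_code i n) = i.
Proof.
rewrite /pair_row pair_codeS lognM ?expn_gt0// pfactorK// logn_coprime ?addn0//.
by rewrite coprime2n/= odd_double.
Qed.

Lemma pair_colK i n : pair_col (pair_code i n) = n.
Proof.
rewrite /pair_col pair_rowK pair_codeS mulKn ?expn_gt0//.
by rewrite -[n.*2.+1]/(true + n.*2)%N half_bit_double.
Qed.

Lemma pair_codeK N : pair_code (pair_row N) (pair_col N) = N.
Proof.
rewrite /pair_code /pair_col; set r := pair_row N.
have /dvdnP[m Nm] : (2 ^ r %| N.+1)%N by exact: pfactor_dvdnn.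
have om : odd m.
  rewrite -(negbK (odd m)); apply/negP => /negPf em.
  have /dvdnP[m' mm'] : (2 %| m)%N by rewrite dvdn2 em.
  have : (2 ^ r.+1 %| N.+1)%N by rewrite Nm mm' -mulnA -expnS dvdn_mull.
  by rewrite pfactor_dvdn// ltnn.
rewrite Nm mulnK ?expn_gt0// mulnC.
by have := odd_double_half m; rewrite om add1n => ->; rewrite -Nm.
Qed.

Lemma pair_code_lt i n k : (k < n)%N -> (pair_code i k < pair_code i n)%N.
Proof.
by move=> kn; rewrite -ltnS !pair_codeS ltn_pmul2l ?expn_gt0// ltnS ltn_double.
Qed.

Lemma pair_code_ge i n : (n <= pair_code i n)%N.
Proof.
rewrite -ltnS pair_codeS; apply: (@leq_trans n.*2.+1).
  by rewrite ltnS -addnn leq_addr.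
by rewrite leq_pmull// expn_gt0.
Qed.

Section Souslin.
Context {d : measure_display} {T : measurableType d} {V : topologicalType}.

(** A scheme is indexed by infinite sequences, with level n depending on their
    first n entries only.  This is the usual scheme over finite sequences, freed
    from truncations. *)
Definition souslin_scheme (A : nat -> (nat -> nat) -> set T)
    (F : nat -> (nat -> nat) -> set V) : Prop :=
  [/\ forall n s t, (forall i, (i < n)%N -> s i = t i) ->
        A n s = A n t /\ F n s = F n t,
      forall n s, measurable (A n s) &
      forall n s, closed (F n s)].

Definition souslin (D : set (T * V)) : Prop :=
  exists A F, souslin_scheme A F /\
    forall w x, D (w, x) <-> exists s, forall n, A n s w /\ F n s x.

Lemma souslin_rectangle (A : set T) (F : set V) :
  measurable A -> closed F -> souslin (A `*` F).
Proof.
move=> mA cF; exists (fun _ _ => A), (fun _ _ => F); split; first by split.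
by move=> w x; split=> [[]|[_ /(_ 0%N)[]]//]; exists id.
Qed.

(** The first entry of the branch chooses the member of the union. *)
Lemma souslin_bigcup (D : nat -> set (T * V)) :
  (forall i, souslin (D i)) -> souslin (\bigcup_i D i).
Proof.
move=> /(_ _)/cid-/all_sig[A] /(_ _)/cid-/all_sig[F] sD.
pose A' n s := if n is n'.+1 then A (s 0%N) n' (fun k => s k.+1) else setT.
pose F' n s := if n is n'.+1 then F (s 0%N) n' (fun k => s k.+1) else setT.
exists A', F'; split; first split.
- case=> [//|n] s t st /=; rewrite -(st 0%N)//.
  by have [[loc _ _] _] := sD (s 0%N); apply: loc => i ni; exact: st.
- by case=> [|n] s /=; [exact: measurableT|have [[_ mA _] _] := sD (s 0%N); exact: mA].
- by case=> [|n] s /=; [exact: closedT|have [[_ _ cF] _] := sD (s 0%N); exact: cF].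
move=> w x; split=> [[i _]|[s sA]].
  have [_ /(_ w x)[+ _]] := sD i => /[apply] -[s sA].
  by exists (fun k => if k is k'.+1 then s k' else i) => -[].
exists (s 0%N) => //; have [_ ->] := sD (s 0%N).
by exists (fun k => s k.+1) => n; exact: (sA n.+1).
Qed.

(** One branch codes a branch for each member; monotonicity of the code makes
    level N of the new scheme depend on N entries. *)
Lemma souslin_bigcap (D : nat -> set (T * V)) :
  (forall i, souslin (D i)) -> souslin (\bigcap_i D i).
Proof.
move=> /(_ _)/cid-/all_sig[A] /(_ _)/cid-/all_sig[F] sD.
pose A' N (s : nat -> nat) :=
  A (pair_row N) (pair_col N) (fun k => s (pair_code (pair_row N) k)).
pose F' N (s : nat -> nat) :=
  F (pair_row N) (pair_col N) (fun k => s (pair_code (pair_row N) k)).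
exists A', F'; split; first split.
- move=> N s t st; have [[loc _ _] _] := sD (pair_row N).
  apply: loc => i iN; apply: st; rewrite -[X in (_ < X)%N]pair_codeK.
  exact: pair_code_lt.
- by move=> N s; have [[_ mA _] _] := sD (pair_row N); exact: mA.
- by move=> N s; have [[_ _ cF] _] := sD (pair_row N); exact: cF.
move=> w x; split=> [DD|[s sA] i _].
  have : forall i, exists s, forall n, A i n s w /\ F i n s x.
    by move=> i; have [_ <-] := sD i; exact: DD.
  move=> /choice[s sA].
  by exists (fun N => s (pair_row N) (pair_col N)) => N;
    rewrite /A' /F'; under eq_fun do rewrite pair_rowK pair_colK.
have [_ ->] := sD i; exists (fun k => s (pair_code i k)) => n.
by have := sA (pair_code i n); rewrite /A' /F' pair_rowK pair_colK.
Qed.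

End Souslin.

Section SouslinMeasurable.
Context {d : measure_display} {T : measurableType d} {R : realType}
  {V : normedModType R}.

(** The points at distance at least 1/(n+1) from the complement. *)
Lemma open_bigcup_closed (U : set V) : open U ->
  exists2 F : nat -> set V, forall n, closed (F n) & U = \bigcup_n F n.
Proof.
move=> oU; exists (fun n => [set x | forall y, ~ U y -> n.+1%:R^-1 <= `|x - y|]).
  move=> n; rewrite (_ : [set x | _] =
      \bigcap_(y in ~` U) [set x | n.+1%:R^-1 <= `|x - y|]); last first.
    by apply/seteqP; split=> x /=.
  apply: closed_bigI => y _.
  apply: (@closed_comp _ _ (fun x : V => `|x - y|) [set r : R | n.+1%:R^-1 <= r]).
    by move=> x _; apply: cvg_norm; apply: cvgB; [exact: cvg_id|exact: cvg_cst].
  exact: closed_ge.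
apply/seteqP; split=> [x Ux|x [n _ /= Fx]]; last first.
  apply: contrapT => nUx; have := Fx _ nUx.
  by rewrite subrr normr0 leNgt invr_gt0 ltr0n.
move: oU; rewrite openE => /(_ _ Ux) /nbhs_ballP[e /= e0 eU].
have [n ne] := exists_invS_lt e0.
exists n => // y nUy /=; rewrite leNgt; apply/negP => xy; apply: nUy; apply: eU.
by rewrite -ball_normE /=; exact: lt_trans ne.
Qed.

(** Souslin sets need not be stable under complement, so the sigma-algebra
    considered is that of the sets which are Souslin together with their
    complements. *)
Lemma souslin_measurable (D : set (T * borelType V)) :
  measurable D -> souslin (D : set (T * V)).
Proof.
pose C := [set D : set (T * V) | souslin D /\ souslin (~` D)].
have C0 : C set0.
  split; first by rewrite -(set0X (setT : set V)); exact: souslin_rectangle.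
  by rewrite setC0 -setXTT; exact: souslin_rectangle.
have CC A : C A -> C (~` A) by move=> [sA sCA]; split=> //; rewrite setCK.
have CU (F : nat -> set (T * V)) : (forall i, C (F i)) -> C (\bigcup_i F i).
  move=> CF; split; first by apply: souslin_bigcup => i; exact: (CF i).1.
  by rewrite setC_bigcup; apply: souslin_bigcap => i; exact: (CF i).2.
move=> mD; suff : C D by case.
move: D mD; apply: smallest_sub.
  by split=> [//|A CA|]; [rewrite setTD; exact: CC|exact: CU].
rewrite subUset; split=> _ [B mB <-]; rewrite setTI.
  split.
    rewrite (_ : _ @^-1` _ = B `*` setT); last first.
      by apply/seteqP; split=> -[] //= ? ? [].
    exact: souslin_rectangle.
  rewrite (_ : ~` _ = (~` B) `*` setT); last first.
    by apply/seteqP; split=> -[] //= ? ? [].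
  by apply: souslin_rectangle => //; exact: measurableC.
move: B mB; apply: smallest_sub.
  split; first by rewrite /= preimage_set0.
    by move=> A CA; rewrite /= setTD preimage_setC; exact: CC.
  by move=> F CF; rewrite /= preimage_bigcup; exact: CU.
move=> U oU /=; split.
  have [F cF ->] := open_bigcup_closed oU; rewrite preimage_bigcup.
  apply: souslin_bigcup => n; rewrite (_ : _ @^-1` _ = setT `*` F n); last first.
    by apply/seteqP; split=> -[] //= ? ? [].
  exact: souslin_rectangle.
rewrite (_ : ~` _ = setT `*` (~` U)); last first.
  by apply/seteqP; split=> -[] //= ? ? [].
by apply: souslin_rectangle => //; exact: open_closedC.
Qed.

(** Intersecting level n.+1 with a ball of radius 1/(2(n+2)) around a dense
    sequence, whose index is coded in the branch, makes the closed sides shrink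
    along every branch. *)
Lemma souslin_shrink (D : set (T * V)) : separable_space V -> souslin D ->
  exists A F, [/\ souslin_scheme A F,
    forall w x, D (w, x) <-> exists s, forall n, A n s w /\ F n s x &
    forall n s x y, F n.+1 s x -> F n.+1 s y -> `|x - y| < n.+1%:R^-1].
Proof.
move=> /dense_sequence[q dq] [A [F [[loc mA cF] DE]]].
pose l (s : nat -> nat) k := pair_row (s k).
pose Bq n (s : nat -> nat) := if n is m.+1
  then [set x : V | `|x - q (pair_col (s m))| <= (2 * n.+1%:R)^-1] else setT.
have cB n s : closed (Bq n s).
  case: n => [|n]; first exact: closedT.
  apply: (@closed_comp _ _ (fun x : V => `|x - q (pair_col (s n))|)
    [set r : R | r <= (2 * n.+2%:R)^-1]).
    by move=> x _; apply: cvg_norm; apply: cvgB; [exact: cvg_id|exact: cvg_cst].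
  exact: closed_le.
exists (fun n s => A n (l s)), (fun n s => F n (l s) `&` Bq n s); split.
- split=> [n s t st|n s|n s]; [|exact: mA|by apply: closedI].
  have [-> ->] := loc n (l s) (l t) (fun i ni => congr1 pair_row (st i ni)).
  split=> //; congr (_ `&` _).
  by case: n st => [//|n] st /=; rewrite st.
- move=> w x; rewrite DE; split=> [[s sA]|[s sA]]; last first.
    by exists (l s) => n; have [? []] := sA n.
  have : forall n, exists k, `|x - q k| < (2 * n.+2%:R)^-1.
    by move=> n; apply: dq; rewrite invr_gt0 mulr_gt0.
  move=> /choice[k kx]; exists (fun n => pair_code (s n) (k n)) => n.
  rewrite /l; under eq_fun do rewrite pair_rowK.
  have [As Fs] := sA n; split=> //; split=> //.
  by case: n {As Fs} => [//|n] /=; rewrite pair_colK ltW.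
- move=> n s x y [_ /= xq] [_ /= yq].
  have xy : `|x - y| <= (2 * n.+2%:R)^-1 + (2 * n.+2%:R)^-1.
    rewrite -(subrKA (q (pair_col (s n)))).
    by apply: le_trans (ler_normD _ _) _; rewrite lerD// distrC.
  apply: le_lt_trans xy _; rewrite invfM -mulrDl (_ : 2^-1 + 2^-1 = 1); last lra.
  by rewrite mul1r ltf_pV2 ?posrE// ltr_nat.
Qed.

End SouslinMeasurable.

(** * Measurable selection *)

(** The first index at which a countable family of measurable conditions holds
    is a measurable choice; off their union the value is a default. *)
Lemma measurable_first (d : measure_display) (T : measurableType d)
    (E : nat -> set T) :
  (forall j, measurable (E j)) ->
  exists k : T -> nat, (forall j, measurable (k @^-1` [set j])) /\
    forall w, (exists j, E j w) -> E (k w) w /\ forall i, (i < k w)%N -> ~ E i w.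
Proof.
move=> mE.
have H w : exists j, ((exists i, E i w) -> E j w /\ forall i, (i < j)%N -> ~ E i w)
    /\ (~ (exists i, E i w) -> j = 0%N).
  have [[i Ei]|nE] := pselect (exists i, E i w); last by exists 0%N.
  have ex : exists i, `[< E i w >] by exists i; exact/asboolP.
  exists (ex_minn ex); case: ex_minnP => m /asboolP Em mmin; split; last first.
    by case; exists i.
  move=> _; split=> // l lm El.
  by have := mmin l (asboolT El); rewrite leqNgt lm.
have [k kP] := choice H; exists k; split; last by move=> w; case: (kP w).
move=> j.
rewrite (_ : _ @^-1` _ = (E j `&` \bigcap_(i in [set i | (i < j)%N]) ~` E i) `|`
  (if j == 0%N then ~` (\bigcup_i E i) else set0)).
  apply: measurableU.
    apply: measurableI => //; apply: bigcap_measurableType => i _.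
    exact: measurableC.
  by case: ifP => _ //; apply: measurableC; exact: bigcupT_measurable.
apply/seteqP; split=> w /=; have [k1 k0] := kP w.
  move=> <-; have [ex|nex] := pselect (exists i, E i w); first by left; exact: k1.
  by right; rewrite (k0 nex)/=; case=> i _ Ei; apply: nex; exists i.
case=> [[Ej jmin]|].
  have [Ek kmin] := k1 (ex_intro _ j Ej).
  case: (ltngtP (k w) j) => // [/jmin|/kmin]//.
by case: eqP => // -> nE; apply: k0 => -[i Ei]; apply: nE; exists i.
Qed.

Section Selection.
Context {d : measure_display} {T : measurableType d} {R : realType}.
Variable mu : probability T R.

(** The outer measure of Z exceeds c: the infimum over measurable covers is
    attained, so the strict inequality may be asked of each of them. *)
Definition outer_gt (c : R) (Z : set T) : Prop :=
  forall B, measurable B -> Z `<=` B -> (c%:E < mu B)%E.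

(** Outer measure is continuous along increasing sequences of arbitrary sets:
    hulls of the Z m for m >= n intersect to an increasing sequence. *)
Lemma outer_gt_bigcup (c : R) (Z : nat -> set T) :
  (forall n m, (n <= m)%N -> Z n `<=` Z m) ->
  outer_gt c (\bigcup_n Z n) -> exists n, outer_gt c (Z n).
Proof.
move=> Zm gtZ; apply: contrapT => nex.
have : forall n, exists B, [/\ measurable B, Z n `<=` B & (mu B <= c%:E)%E].
  move=> n; apply: contrapT => nB; apply: nex; exists n => B mB ZB.
  by rewrite ltNge; apply/negP => Bc; apply: nB; exists B.
move=> /choice[B BP].
pose G n := \bigcap_(m in [set m | (n <= m)%N]) B m.
have mG n : measurable (G n).
  by apply: bigcap_measurableType => m _; have [] := BP m.
have mUG : measurable (\bigcup_n G n) by exact: bigcupT_measurable.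
have GB n : G n `<=` B n by move=> w; apply => /=.
have cG : mu \o G @ \oo --> mu (\bigcup_n G n).
  apply: nondecreasing_cvg_mu => // n m nm; apply/subsetPset => w Gw i /= mi.
  by apply: Gw => /=; exact: leq_trans mi.
have : (c%:E < mu (\bigcup_n G n))%E.
  apply: gtZ => // w [n _ Zw]; exists n => // m /= nm.
  by have [_ + _] := BP m; apply; exact: Zm Zw.
rewrite ltNge => /negP; apply.
rewrite -(cvg_lim (@ereal_hausdorff R) cG).
apply: lime_le; first by apply/cvg_ex; exists (mu (\bigcup_n G n)).
apply: nearW => n; have [mB _ Bc] := BP n.
by apply: le_trans Bc; apply: le_measure; rewrite ?inE.
Qed.

Context {V : completeNormedModType R}.

(** Cantor's intersection theorem along a sequence of points that meets the first
    N sets at stage N. *)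
Lemma shrinking_point (F : nat -> set V) :
  (forall n, closed (F n)) ->
  (forall n x y, F n.+1 x -> F n.+1 y -> `|x - y| < n.+1%:R^-1) ->
  forall z : nat -> V, (forall N n, (n <= N)%N -> F n (z N)) ->
  cvgn z /\ forall n, F n (limn z).
Proof.
move=> cF dF z zF.
have cz : cvgn z.
  apply/cauchy_cvgP; apply: cauchy_exP => e e0.
  have [m me] := exists_invS_lt e0.
  exists (z m.+1); exists m.+1 => // n /= mn; rewrite -ball_normE/=.
  by apply: lt_trans me; apply: (dF m); apply: zF.
split=> // n.
apply: (@closed_cvg _ _ _ eventually_filter z (F n)) => //.
by near=> N; apply: zF; near: N; exact: nbhs_infty_ge.
Unshelve. all: by end_near. Qed.


(** Capacity argument.  Continuity of the outer measure gives bounds, one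
    coordinate at a time, keeping it above c.  The bounded branches form a
    finitely branching tree, so by the lemma of Koenig a point survives all
    levels as soon as it survives each of them, and the set of such points is
    measurable, of measure at least c. *)
Lemma selection_outer_gt (c : R) (D : set (T * borelType V)) :
  separable_space V -> measurable D ->
  outer_gt c [set w | exists x, D (w, x)] ->
  exists A (zeta : T -> V), [/\ measurable A, borel_fun zeta,
    forall w, A w -> D (w, zeta w) & (c%:E <= mu A)%E].
Proof.
move=> sepV mD cD.
have [A [F [[loc mA cF] DE dF]]] := souslin_shrink sepV (souslin_measurable mD).
pose FF N s : set V := \bigcap_(n in [set n | (n <= N)%N]) F n s.
pose B N s : set T :=
  [set w | FF N s !=set0 /\ forall n, (n <= N)%N -> A n s w].
have locFF N s t : (forall i, (i < N)%N -> s i = t i) -> FF N s = FF N t.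
  move=> st; apply: eq_bigcapr => n /= nN.
  by have [] := loc n s t (fun i ni => st i (leq_trans ni nN)).
have locB N s t : (forall i, (i < N)%N -> s i = t i) -> B N s = B N t.
  move=> st; rewrite /B (locFF _ _ _ st); apply/seteqP.
  split=> w [Fne Aw]; split=> // n nN.
    have [<- _] := loc n s t (fun i ni => st i (leq_trans ni nN)); exact: Aw.
  have [-> _] := loc n s t (fun i ni => st i (leq_trans ni nN)); exact: Aw.
have mB N s : measurable (B N s).
  have [ne|ne] := pselect (FF N s !=set0); last first.
    by rewrite (_ : B N s = set0)// -subset0 => w [].
  rewrite (_ : B N s = \bigcap_(n in [set n | (n <= N)%N]) A n s).
    exact: bigcap_measurableType.
  by apply/seteqP; split=> w /=; [case|].
have Bm N M s : (N <= M)%N -> B M s `<=` B N s.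
  move=> NM w [[x Fx] Aw]; split; last by move=> n nN; apply/Aw/(leq_trans nN).
  by exists x => n /= nN; apply: Fx => /=; exact: leq_trans NM.
(* the bounds confining the branches to a compact set *)
pose Z (b : seq nat) := [set w | exists s,
  (forall i, (i < size b)%N -> (s i <= nth 0 b i)%N) /\ forall N, B N s w].
have stepZ b : outer_gt c (Z b) -> exists j, outer_gt c (Z (rcons b j)).
  move=> gtZ; apply: outer_gt_bigcup => [n m nm w [s [sb sB]]|].
    exists s; split=> // i; rewrite size_rcons => ib.
    apply: leq_trans (sb i _) _; first by rewrite size_rcons.
    by rewrite !nth_rcons; do 2 case: ifP => // _.
  move=> C mC ZC; apply: gtZ => // w [s [sb sB]]; apply: ZC.
  exists (s (size b)) => //; exists s; split=> // i.
  rewrite size_rcons ltnS leq_eqVlt nth_rcons.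
  by case: ltngtP => //= [ib _|-> _]; first exact: sb.
have /choice[f fP] : forall b, exists j,
    outer_gt c (Z b) -> outer_gt c (Z (rcons b j)).
  move=> b; have [gtZ|ngtZ] := pselect (outer_gt c (Z b)); last by exists 0%N.
  by have [j] := stepZ b gtZ; exists j.
pose pre n := iter n (fun b => rcons b (f b)) [::].
pose bd n := f (pre n).
have preE n : pre n = mkseq bd n.
  by elim: n => // n IH; rewrite mkseqS -IH.
have gtpre n : outer_gt c (Z (pre n)).
  elim: n => [|n IH]; last exact: fP.
  move=> C mC ZC; apply: cD => // w [x]; rewrite DE => -[s sA]; apply: ZC.
  exists s; split=> // N; split; last by move=> n _; case: (sA n).
  by exists x => n _; case: (sA n).
have gtbd N : outer_gt c [set w | exists s,
    (forall i, (i < N)%N -> (s i <= bd i)%N) /\ B N s w].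
  move=> C mC ZC; apply: (gtpre N) => // w [s [sb sB]]; apply: ZC.
  exists s; split=> // i iN; have := sb i.
  by rewrite preE size_mkseq nth_mkseq// => /(_ iN).
pose Q N b := [set w | exists s, [/\ forall i, (i < size b)%N -> s i = nth 0%N b i,
  forall i, (i < N)%N -> (s i <= bd i)%N & B N s w]].
have mQ N b : measurable (Q N b).
  pose ok (t : seq nat) := (forall i, (i < size b)%N -> nth 0%N t i = nth 0%N b i)
    /\ forall i, (i < N)%N -> (nth 0%N t i <= bd i)%N.
  rewrite (_ : Q N b = \bigcup_(t : seq nat) [set w | ok t /\ B N (nth 0%N t) w]).
    apply: countable_bigcupT_measurable => [|t]; first exact: countableP.
    have [okt|nokt] := pselect (ok t).
      by rewrite (_ : [set w | _] = B N (nth 0%N t))//; apply/seteqP; split=> w /=; [case|].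
    by rewrite (_ : [set w | _] = set0)// -subset0 => w [].
  apply/seteqP; split=> [w [s [sb sbd sB]]|w [t _ /= [[tb tbd] tB]]]; last first.
    by exists (nth 0%N t).
  exists (mkseq s (maxn N (size b))) => //=; split; first split=> i ib.
  - by rewrite nth_mkseq ?sb// leq_max ib orbT.
  - by rewrite nth_mkseq ?sbd// leq_max ib.
  - rewrite (locB _ _ s)// => i iN; by rewrite nth_mkseq// leq_max iN.
have Qm N M b : (N <= M)%N -> Q M b `<=` Q N b.
  move=> NM w [s [sb sbd sB]]; exists s; split=> //; last exact: Bm sB.
  by move=> i iN; apply/sbd/(leq_trans iN).
pose S b := \bigcap_N Q N b.
have mS b : measurable (S b) by exact: bigcapT_measurable.
have muS : (c%:E <= mu (S [::]))%E.
  have cS : mu \o (fun N => Q N [::]) @ \oo --> mu (S [::]).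
    apply: nonincreasing_cvg_mu => [|N||]; [|exact: mQ|exact: mS|].
      by rewrite (le_lt_trans (probability_le1 _ _))// ltry.
    by move=> n m nm; apply/subsetPset; exact: Qm.
  rewrite -(cvg_lim (@ereal_hausdorff R) cS); apply: lime_ge.
    by apply/cvg_ex; exists (mu (S [::])).
  apply: nearW => N; apply/ltW/(gtbd N) => //.
  by move=> w [s [sb sB]]; exists s.
(* the bounds leave finitely many ways to extend b by one entry, and the
   sets Q N decrease with N *)
have stepS b w : S b w -> exists j, S (rcons b j) w.
  move=> Sw; apply: contrapT => nS.
  have : forall j, exists N, ~ Q N (rcons b j) w.
    move=> j; apply: contrapT => nQ; apply: nS; exists j => N _.
    by apply: contrapT => nQN; apply: nQ; exists N.
  move=> /choice[N nQ].
  pose M := maxn (size b).+1 (\max_(j < (bd (size b)).+1) N j).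
  have [s [sb sbd sB]] := Sw M I.
  have jb : (s (size b) < (bd (size b)).+1)%N.
    by rewrite ltnS sbd// leq_max leqnn.
  apply: (nQ (s (size b))).
  apply: (@Qm _ M); first by rewrite leq_max (leq_bigmax (Ordinal jb)) orbT.
  exists s; split=> // i; rewrite size_rcons ltnS leq_eqVlt nth_rcons.
  by case: ltngtP => //= [ib _|-> _]; first exact: sb.
have : forall b, exists k : T -> nat, (forall j, measurable (k @^-1` [set j])) /\
    forall w, (exists j, S (rcons b j) w) -> S (rcons b (k w)) w.
  move=> b; have [k [mk kP]] := measurable_first (fun j => mS (rcons b j)).
  by exists k; split=> // w /kP[].
move=> /choice[k kP].
(* from each prefix, the least admissible entry *)
pose br n w := iter n (fun b => rcons b (k b w)) [::].
have mbr n b : measurable [set w | br n w = b].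
  elim: n b => [|n IH] b.
    have [->|nb] := pselect (b = [::]).
      by rewrite (_ : [set w | _] = setT)//; apply/seteqP; split.
    by rewrite (_ : [set w | _] = set0)// -subset0 => w /= h; apply: nb.
  case/lastP: b => [|b j].
    by rewrite (_ : [set w | _] = set0)// -subset0 => w /= /(congr1 size);
      rewrite size_rcons.
  rewrite (_ : [set w | _] = [set w | br n w = b] `&` k b @^-1` [set j]).
    by apply: measurableI => //; case: (kP b).
  apply/seteqP; split=> w /=; last by case=> -> ->.
  by move=> /rcons_inj[-> ->].
have size_br n w : size (br n w) = n by elim: n => //= n IH; rewrite size_rcons IH.
pose sg w n := nth 0%N (br n.+1 w) n.
have brE n w : br n w = mkseq (sg w) n.
  elim: n => // n IH; rewrite mkseqS -IH /sg /= nth_rcons size_br ltnn eqxx.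
  by [].
have Sbr w n : S [::] w -> S (br n w) w.
  by move=> Sw; elim: n => //= n IH; have [_] := kP (br n w); apply; exact: stepS.
have Bsg w n : S [::] w -> B n (sg w) w.
  move=> /(Sbr _ n) /(_ n I)[s [sb _ sB]].
  rewrite (locB _ _ s)// => i iN; rewrite sb ?size_br//.
  by rewrite brE nth_mkseq.
pose pt n b : V := xget 0 (FF n (nth 0%N b)).
have ptP w N : S [::] w -> FF N (sg w) (pt N (br N w)).
  move=> /(Bsg _ N)[ne _]; have -> : FF N (sg w) = FF N (nth 0%N (br N w)).
    by apply: locFF => i iN; rewrite brE nth_mkseq.
  rewrite /pt; case: xgetP => [y -> //|nF].
  by case: ne => y; rewrite (locFF _ _ (nth 0%N (br N w))) => [/nF|i iN];
    rewrite ?brE ?nth_mkseq.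
have ptS w : S [::] w -> cvgn (fun n => pt n (br n w)) /\
    forall n, F n (sg w) (limn (fun n => pt n (br n w))).
  move=> Sw; apply: (shrinking_point (F := fun n => F n (sg w))) => [//|n x y|N n nN].
    exact: dF.
  exact: (ptP w N Sw n nN).
pose zeta w := if `[< S [::] w >] then limn (fun n => pt n (br n w)) else 0.
exists (S [::]), zeta; split=> //.
  apply: (@borel_fun_cvg _ _ _ _ sepV
    (fun n w => if `[< S [::] w >] then pt n (br n w) else 0)) => [n|w].
    apply: measurable_fun_if_set => //.
    by apply: (measurable_fun_glue (T' := borelType V) (k := br n) (f := fun b _ => pt n b)) ;
      [exact: mbr|move=> b; exact: measurable_cst].
  rewrite /zeta; case: asboolP => Sw; last exact: cvg_cst.
  by have [] := ptS w Sw.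
move=> w Sw; apply/DE; exists (sg w) => n; split.
  by have [_ +] := Bsg w n Sw; apply.
by rewrite /zeta; case: asboolP => // _; have [_] := ptS w Sw.
Qed.


(** Gluing the selections obtained for c close to the outer measure of the
    projection exhausts it up to a null set. *)
Lemma measurable_selection (D : set (T * borelType V)) :
  separable_space V -> measurable D ->
  exists A (zeta : T -> V), [/\ measurable A, borel_fun zeta,
    forall w, A w -> D (w, zeta w) &
    mu.-negligible [set w | ~ A w /\ exists x, D (w, x)]].
Proof.
move=> sepV mD; pose Z := [set w | exists x, D (w, x)].
pose hulls := [set mu B | B in [set B | measurable B /\ Z `<=` B]].
have inf_le B : measurable B -> Z `<=` B -> (ereal_inf hulls <= mu B)%E.
  by move=> mB ZB; apply: ereal_inf_lbound; exists B.
have inf_fin : ereal_inf hulls \is a fin_num.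
  rewrite ge0_fin_numE.
    by apply: le_lt_trans (inf_le setT _ _) _ => //; rewrite probability_setT ltry.
  by apply: le_ereal_inf_tmp => _ [B _ <-]; exact: measure_ge0.
pose c := fine (ereal_inf hulls).
have cE : ereal_inf hulls = c%:E by rewrite fineK.
have : forall n, exists B, [/\ measurable B, Z `<=` B &
    (mu B < (c + n.+1%:R^-1)%:E)%E].
  move=> n; have n0 : 0 < n.+1%:R^-1 :> R by rewrite invr_gt0.
  have [_ [B [mB ZB] <-]] := lb_ereal_inf_adherent n0 inf_fin.
  by rewrite cE => muB; exists B.
move=> /choice[B BP].
have : forall n, exists Az : set T * (T -> V), [/\ measurable Az.1, borel_fun Az.2,
    forall w, Az.1 w -> D (w, Az.2 w) & ((c - n.+1%:R^-1)%:E <= mu Az.1)%E].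
  move=> n.
  have [|A [z [mA mz Dz cA]]] := @selection_outer_gt (c - n.+1%:R^-1) D sepV mD.
    move=> C mC ZC; apply: lt_le_trans (inf_le C mC ZC).
    by rewrite cE lte_fin ltrBlDr ltrDl invr_gt0.
  by exists (A, z).
move=> /choice[Az AzP].
have mA n : measurable (Az n).1 by case: (AzP n).
have [k [mk kP]] := measurable_first mA.
pose A := \bigcup_n (Az n).1.
have mUA : measurable A by exact: bigcupT_measurable.
exists A, (fun w => (Az (k w)).2 w); split=> //.
- apply: (measurable_fun_glue (T' := borelType V) (f := fun n => (Az n).2)) => // n.
  by case: (AzP n).
- move=> w [n _ Aw]; have [_ _ + _] := AzP (k w); apply.
  by have [] := kP w (ex_intro _ n Aw).
have AZ : A `<=` Z.
  by move=> w [n _ Aw]; have [_ _ + _] := AzP n => /(_ w Aw); exists ((Az n).2 w).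
exists (\bigcap_n B n `\` A); split.
- by apply: measurableD => //; apply: bigcapT_measurable => n; case: (BP n).
- apply/eqP; rewrite eq_le measure_ge0 andbT; apply/lee_addgt0Pr => e e0.
  rewrite add0e; have [n ne] := exists_invS_lt (divr_gt0 e0 (ltr0Sn R 1)).
  have [mB ZB Bc] := BP n.
  have : (mu (\bigcap_n B n `\` A) <= mu (B n `\` A))%E.
    apply: le_measure; rewrite ?inE.
    + by apply: measurableD => //; apply: bigcapT_measurable => m; case: (BP m).
    + exact: measurableD.
    + by move=> w [Bw nA]; split=> //; exact: Bw.
  move=> /le_trans; apply; rewrite measureD//; last first.
    by rewrite (le_lt_trans (probability_le1 _ _))// ltry.
  rewrite setIidr; last exact: subset_trans ZB.
  have cA : ((c - n.+1%:R^-1)%:E <= mu A)%E.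
    have [_ _ _ /le_trans] := AzP n; apply; apply: le_measure; rewrite ?inE//.
    by move=> w Aw; exists n.
  move: Bc cA.
  rewrite -(fineK (fin_num_measure mu _ mB)) -(fineK (fin_num_measure mu _ mUA)).
  rewrite lte_fin !lee_fin => Bc cA.
  have arith (a b r x : R) : b < x + r -> x - r <= a -> r < e / 2 -> b - a <= e.
    by clear; lra.
  by rewrite -(fineK (fin_num_measure mu _ mB)) -(fineK (fin_num_measure mu _ mUA));
    rewrite lee_fin; exact: arith Bc cA ne.
- move=> w [nA Zw]; split=> // n _; have [_ + _] := BP n; exact.
Qed.

End Selection.

(** * Bochner integrals *)

Section Bochner.
Context {d : measure_display} {W : measurableType d} {R : realType}
  {V : completeNormedModType R}.
Variable P : probability W R.
Hypothesis sepV : separable_space V.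

Lemma measurable_sub_sigma (H : set (set W)) : sigma_algebra [set: W] H ->
  (measurable : set (set (g_sigma_algebraType H))) = H.
Proof. exact: (@measurable_g_measurableTypeE W H). Qed.

Lemma random_element_measurableE (f : W -> V) :
  random_element measurable f <-> borel_fun f.
Proof.
rewrite /random_element /measurable_fun.
by split=> mf _ B mB; 
  have := mf measurableT B mB; rewrite (measurable_sub_sigma (sigma_algebra_measurable W)).
Qed.

(** The index type I carries no sigma-algebra; measurability comes from the
    finitely many fibers of u. *)
Lemma measurable_fun_finite_range d' (T' : measurableType d') (I : choiceType)
    (u : W -> I) (phi : I -> T') (r : seq I) :
  (forall w, u w \in r) -> (forall i, measurable (u @^-1` [set i])) ->
  measurable_fun setT (fun w => phi (u w)).
Proof.
move=> uW mu _ B mB; rewrite setTI.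
rewrite (_ : _ @^-1` B =
    \big[setU/set0]_(i <- r | `[< B (phi i) >]) (u @^-1` [set i])).
  exact: bigsetU_measurable.
rewrite -bigcup_seq_cond; apply/seteqP; split=> w.
  by move=> Bw; exists (u w) => //=; apply/andP; split; [exact: uW|exact/asboolP].
by move=> [x /= /andP[_ /asboolP Bx] uwx]; rewrite /= uwx.
Qed.

(** The values of s = phi o u may repeat over distinct values of u; grouping the
    latter gives the integral.  Taking for u a joint map makes it possible to
    compare two simple functions. *)
Lemma simple_integral_comp (I : choiceType) (u : W -> I) (phi : I -> V)
    (r : seq I) (A : set W) :
  uniq r -> (forall w, u w \in r) -> (forall i, measurable (u @^-1` [set i])) ->
  measurable A ->
  simple_integral P A (phi \o u) =
  \sum_(i <- r) fine (P (A `&` u @^-1` [set i])) *: phi i.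
Proof.
move=> ur uW mu mA; rewrite /simple_integral.
pose s := undup (map phi r).
rewrite (@fsbigE _ _ _ _ _ s) ?undup_uniq//; last first.
  move=> x _ xs; rewrite (_ : _ `&` _ = set0) ?measure0 ?scale0r//.
  rewrite -subset0 => w [_ /= uwx]; move/negP: xs; apply.
  by rewrite mem_undup -uwx map_f.
under eq_bigl do rewrite in_setT.
transitivity (\sum_(x <- s) \sum_(i <- r | phi i == x)
    fine (P (A `&` u @^-1` [set i])) *: phi i).
  apply: eq_bigr => x _.
  transitivity ((\sum_(i <- r | phi i == x)
      fine (P (A `&` u @^-1` [set i]))) *: x); last first.
    by rewrite scaler_suml; apply: eq_bigr => i /eqP ->.
  congr (_ *: x); rewrite sum_fine; last first.
    by move=> i _; apply: fin_num_measure; exact: measurableI.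
  congr fine; rewrite -big_filter (fsbig_seq _ _ (filter_uniq _ ur)).
  rewrite -measure_fin_bigcup//=.
  - congr (P _); apply/seteqP; split=> w /=.
      move=> [Aw uwx]; exists (u w) => //=.
      by rewrite mem_filter uwx eqxx uW.
    by move=> [i /=]; rewrite mem_filter => /andP[/eqP <- _] [Aw ->].
  - by move=> i j _ _ [w [[_ /= <-] [_ /= <-]]].
  - by move=> i _; exact: measurableI.
rewrite (exchange_big_dep xpredT)//= [RHS]big_seq [LHS]big_seq.
apply: eq_bigr => i ir.
rewrite big_mkcond (bigD1_seq (phi i)) ?undup_uniq ?mem_undup ?map_f//= eqxx.
by rewrite big1 ?addr0// => x xi; rewrite eq_sym (negPf xi).
Qed.

Lemma integral_simple_comp (I : choiceType) (u : W -> I) (h : I -> R)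
    (r : seq I) (A : set W) :
  uniq r -> (forall w, u w \in r) -> (forall i, measurable (u @^-1` [set i])) ->
  measurable A -> (forall i, 0 <= h i) ->
  (\int[P]_(w in A) (h (u w))%:E =
    (\sum_(i <- r) fine (P (A `&` u @^-1` [set i])) * h i)%:E)%E.
Proof.
move=> ur uW mu mA h0.
have mAu i : measurable (A `&` u @^-1` [set i]) by exact: measurableI.
have AE : A = \big[setU/set0]_(i <- r) (A `&` u @^-1` [set i]).
  rewrite -bigcup_seq; apply/seteqP; split=> w; last by move=> [i _ []].
  by move=> Aw; exists (u w) => //=.
rewrite {1}AE ge0_integral_bigsetU//; last 3 first.
- by move=> i j _ _ [w [[_ /= <-] [_ /= <-]]].
- rewrite -AE; apply/measurable_EFinP; apply: (@measurable_funS _ _ _ _ setT) => //.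
  exact: (@measurable_fun_finite_range _ _ _ u h r).
- by move=> w _; rewrite lee_fin.
rewrite -sumEFin; apply: eq_bigr => i _.
rewrite (eq_integral (cst (h i)%:E)); last by move=> w; rewrite inE => -[_ /= ->].
by rewrite integral_cst// EFinM fineK ?fin_num_measure// muleC.
Qed.

Lemma simple_joint (I J : choiceType) (s : W -> I) (t : W -> J) :
  finite_set (range s) -> finite_set (range t) ->
  (forall i, measurable (s @^-1` [set i])) ->
  (forall i, measurable (t @^-1` [set i])) ->
  exists r : seq (I * J), [/\ uniq r, forall w, (s w, t w) \in r &
    forall i, measurable ((fun w => (s w, t w)) @^-1` [set i])].
Proof.
move=> /finite_seqP[rs rsE] /finite_seqP[rt rtE] ms mt.
exists (undup [seq (i, j) | i <- rs, j <- rt]); split; first exact: undup_uniq.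
  move=> w; rewrite mem_undup; apply: allpairs_f.
    have : range s (s w) by exists w.
  by rewrite rsE.
  have : range t (t w) by exists w.
  by rewrite rtE.
move=> [i j]; rewrite (_ : _ @^-1` _ = s @^-1` [set i] `&` t @^-1` [set j]).
  exact: measurableI.
by apply/seteqP; split=> w /=; [case=> -> ->|case=> <- <-].
Qed.

Lemma simple_element_fiber (s : W -> V) x :
  simple_element s -> measurable (s @^-1` [set x]).
Proof.
move=> [/random_element_measurableE ms _]; apply: borel_fun_preimage => //.
rewrite -[X in measurable X]setCK; apply: measurableC.
apply: sub_sigma_algebra; apply: closed_openC.
exact: (accessible_closed_set1 (hausdorff_accessible (@norm_hausdorff _ V))).
Qed.

Lemma simple_integral_dist (s t : W -> V) (A : set W) :
  simple_element s -> simple_element t -> measurable A ->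
  ((`|simple_integral P A s - simple_integral P A t|)%:E <=
   \int[P]_(w in A) `|s w - t w|%:E)%E.
Proof.
move=> ss st mA.
have [r [ur rW mu]] := simple_joint ss.2 st.2
  (fun x => simple_element_fiber x ss) (fun x => simple_element_fiber x st).
rewrite (@integral_simple_comp _ _ (fun p => `|p.1 - p.2|) r A ur rW mu mA)//.
rewrite (@simple_integral_comp _ _ fst r A ur rW mu mA).
rewrite (@simple_integral_comp _ _ snd r A ur rW mu mA).
rewrite lee_fin -sumrB; apply: le_trans (ler_norm_sum _ _ _) _.
apply: ler_sum => i _; rewrite -scalerBr normrZ ger0_norm//.
exact: fine_ge0.
Qed.

Lemma simple_elementP (s : W -> V) :
  simple_element s <->
  finite_set (range s) /\ forall x, measurable (s @^-1` [set x]).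
Proof.
split=> [ss|[fs ms]]; first by split=> [|x]; [case: ss|exact: simple_element_fiber].
split=> //; apply/random_element_measurableE.
have /finite_seqP[r rE] := fs.
apply: (@measurable_fun_finite_range _ (borelType V) V s (fun x => x) r) => // w.
have : range s (s w) by exists w.
  by rewrite rE.
Qed.

Lemma simple_element_comp (I : choiceType) (u : W -> I) (phi : I -> V) :
  finite_set (range u) -> (forall i, measurable (u @^-1` [set i])) ->
  simple_element (phi \o u).
Proof.
move=> fu mu; apply/simple_elementP; split.
  by rewrite -(image_comp u phi); exact: finite_image.
move=> x; move: fu => /finite_seqP[r rE].
rewrite (_ : _ @^-1` _ = \big[setU/set0]_(i <- r | phi i == x) (u @^-1` [set i])).
  exact: bigsetU_measurable.
rewrite -bigcup_seq_cond; apply/seteqP; split=> w.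
  move=> /= <-; exists (u w) => //=; apply/andP; split => //.
  have : range u (u w) by exists w.
  by rewrite rE.
by move=> [i /= /andP[_ /eqP <-] <-].
Qed.

Lemma simple_elementD (s t : W -> V) :
  simple_element s -> simple_element t ->
  simple_element (fun w => s w + t w) /\ forall A, measurable A ->
  simple_integral P A (fun w => s w + t w) =
  simple_integral P A s + simple_integral P A t.
Proof.
move=> ss st.
have [r [ur rW mu]] := simple_joint ss.2 st.2
  (fun x => simple_element_fiber x ss) (fun x => simple_element_fiber x st).
split=> [|A mA].
  apply: (@simple_element_comp _ (fun w => (s w, t w)) (fun p => p.1 + p.2)) => //.
  apply: (sub_finite_set _ (finite_seq r)) => _ [w _ <-]; exact: rW.
rewrite (@simple_integral_comp _ _ (fun p => p.1 + p.2) r A ur rW mu mA).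
rewrite (@simple_integral_comp _ _ fst r A ur rW mu mA).
rewrite (@simple_integral_comp _ _ snd r A ur rW mu mA).
by rewrite -big_split/=; apply: eq_bigr => i _; rewrite scalerDr.
Qed.


Local Notation L1dist A f g := (\int[P]_(w in A) `|f w - g w|%:E)%E.

Lemma measurable_L1dist (A : set W) (f g : W -> V) :
  borel_fun f -> borel_fun g ->
  measurable_fun A (fun w => `|f w - g w|%:E).
Proof.
move=> mf mg; apply/measurable_EFinP; apply: (@measurable_funS _ _ _ _ setT) => //.
exact: measurable_fun_dist.
Qed.

Lemma L1dist_triangle (A : set W) (f g h : W -> V) :
  measurable A -> borel_fun f -> borel_fun g -> borel_fun h ->
  (L1dist A f h <= L1dist A f g + L1dist A g h)%E.
Proof.
move=> mA mf mg mh; rewrite -ge0_integralD//; try exact: measurable_L1dist.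
apply: ge0_le_integral => //; first exact: measurable_L1dist.
- by apply: emeasurable_funD; exact: measurable_L1dist.
- by move=> w _; rewrite -EFinD lee_fin -(subrKA (g w)) ler_normD.
Qed.

Lemma L1distC (A : set W) (f g : W -> V) : L1dist A f g = L1dist A g f.
Proof. by apply: eq_integral => w _; rewrite distrC. Qed.

Lemma L1dist_ge0 (A : set W) (f g : W -> V) : (0 <= L1dist A f g)%E.
Proof. by apply: integral_ge0 => w _; rewrite lee_fin. Qed.

Lemma simple_element_borel (s : W -> V) : simple_element s -> borel_fun s.
Proof. by case=> /random_element_measurableE. Qed.

(** The contraction property of simple integrals passes to the limit. *)
Lemma bochner_integral_dist (A : set W) (f phi : W -> V) (v : V) :
  measurable A -> borel_fun f -> is_bochner_integral P A f v ->
  simple_element phi ->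
  (`|v - simple_integral P A phi|%:E <= L1dist A f phi)%E.
Proof.
move=> mA mf [s [ss sf sv]] sphi.
have msn n := simple_element_borel (ss n).
have mphi := simple_element_borel sphi.
have cl : `|simple_integral P A (s n) - simple_integral P A phi|%:E @[n --> \oo]
    --> `|v - simple_integral P A phi|%:E.
  by apply: cvg_EFin; [exact: nearW|apply: cvg_norm; apply: cvgB => //; exact: cvg_cst].
have cr : (L1dist A f (s n) + L1dist A f phi)%E @[n --> \oo]
    --> (0 + L1dist A f phi)%E.
  apply: cvgeD sf (cvg_cst _).
  by apply: ge0_adde_def; rewrite inE//; exact: L1dist_ge0.
rewrite -[leRHS]add0e -(cvg_lim (@ereal_hausdorff R) cl).
rewrite -(cvg_lim (@ereal_hausdorff R) cr); apply: lee_lim.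
- by apply/cvg_ex; eexists; exact: cl.
- by apply/cvg_ex; eexists; exact: cr.
apply: nearW => n; apply: le_trans (simple_integral_dist (ss n) sphi mA) _.
by rewrite (L1distC A f (s n)); exact: L1dist_triangle.
Qed.

(** Diagonal choice among the simple approximations of the fn n. *)
Lemma bochner_integral_lim (A : set W) (f : W -> V) (v : V)
    (fn : nat -> W -> V) (vn : nat -> V) :
  measurable A -> borel_fun f -> (forall n, borel_fun (fn n)) ->
  (forall n, is_bochner_integral P A (fn n) (vn n)) ->
  L1dist A f (fn n) @[n --> \oo] --> 0%E -> vn n @[n --> \oo] --> v ->
  is_bochner_integral P A f v.
Proof.
move=> mA mf mfn bfn ffn vnv.
have : forall n, exists s, [/\ simple_element s,
    (L1dist A (fn n) s < n.+1%:R^-1%:E)%E &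
    `|vn n - simple_integral P A s| < n.+1%:R^-1].
  move=> n; have [s [ss sf sv]] := bfn n.
  have n0 : 0 < n.+1%:R^-1 :> R by rewrite invr_gt0.
  have near1 : \forall k \near \oo, (L1dist A (fn n) (s k) < n.+1%:R^-1%:E)%E.
    apply: (sf [set x | (x < n.+1%:R^-1%:E)%E]).
    by apply: open_nbhs_nbhs; split; [exact: open_ereal_lt_ereal|rewrite /= lte_fin].
  have near2 : \forall k \near \oo,
      `|vn n - simple_integral P A (s k)| < n.+1%:R^-1.
    by move/cvgrPdist_lt : sv; apply.
  have [k [k1 k2]] := filter_ex (@filterI _ _ _ _ _ near1 near2).
  by exists (s k).
move=> /choice[s sP]; exists s; split.
- by move=> n; case: (sP n).
- have cr : (L1dist A f (fn n) + n.+1%:R^-1%:E)%E @[n --> \oo] --> (0 + 0%:E)%E.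
    apply: cvgeD => //; apply: cvg_EFin; first exact: nearW.
    exact: cvg_harmonic.
  rewrite adde0 in cr; apply: (squeeze_cvge _ (cvg_cst _) cr).
  apply: nearW => n; rewrite L1dist_ge0/=; have [ss sf _] := sP n.
  apply: le_trans (L1dist_triangle mA mf (mfn n) (simple_element_borel ss)) _.
  by rewrite leeD2l// ltW.
- apply/cvgrPdist_lt => e e0; have e20 : 0 < e / 2 by rewrite divr_gt0.
  near=> n; have [_ _ sv] := sP n.
  rewrite -(subrKA (vn n)) [e]splitr; apply: le_lt_trans (ler_normD _ _) _.
  apply: ltrD.
    by near: n; move/cvgrPdist_lt : vnv; apply.
  apply: lt_trans sv _; near: n; exact: (near_infty_natSinv_lt (PosNum e20)).
Unshelve. all: by end_near. Qed.

Lemma bochner_integralD (A : set W) (f g : W -> V) (v u : V) :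
  measurable A -> borel_fun f -> borel_fun g ->
  is_bochner_integral P A f v -> is_bochner_integral P A g u ->
  is_bochner_integral P A (fun w => f w + g w) (v + u).
Proof.
move=> mA mf mg [s [ss sf sv]] [t [st tg tu]].
exists (fun n w => s n w + t n w); split.
- by move=> n; case: (simple_elementD (ss n) (st n)).
- have cr : (L1dist A f (s n) + L1dist A g (t n))%E @[n --> \oo] --> (0 + 0)%E.
    exact: cvgeD.
  rewrite adde0 in cr; apply: (squeeze_cvge _ (cvg_cst _) cr).
  apply: nearW => n; rewrite L1dist_ge0/=.
  have ms := simple_element_borel (ss n); have mt := simple_element_borel (st n).
  rewrite -ge0_integralD//; try exact: measurable_L1dist.
  apply: ge0_le_integral => //.
  + by apply: measurable_L1dist; exact: borel_funD.
  + by apply: emeasurable_funD; exact: measurable_L1dist.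
  + by move=> w _; rewrite -EFinD lee_fin opprD addrACA ler_normD.
- under eq_fun do rewrite (simple_elementD (ss _) (st _)).2//.
  exact: cvgD.
Qed.

Lemma bochner_integral0 (A : set W) : measurable A ->
  is_bochner_integral P A (fun _ => 0 : V) 0.
Proof.
move=> mA; exists (fun _ _ => 0); split.
- move=> _; apply/simple_elementP; split.
    by apply: (sub_finite_set _ (finite_set1 (0 : V))) => _ [w _ <-].
  move=> x; have [->|x0] := eqVneq x 0.
    by rewrite (_ : _ @^-1` _ = setT)//; apply/seteqP; split.
  rewrite (_ : _ @^-1` _ = set0)//; rewrite -subset0 => w /= x00.
  by rewrite -x00 eqxx in x0.
- under eq_fun do under eq_integral do rewrite subrr normr0.
  by rewrite integral0; exact: cvg_cst.
- rewrite (_ : simple_integral _ _ _ = 0); first exact: cvg_cst.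
  rewrite /simple_integral fsbig1// => x _.
  have [->|x0] := eqVneq x 0; first by rewrite scaler0.
  rewrite (_ : _ `&` _ = set0) ?measure0 ?scale0r//.
  by rewrite -subset0 => w [_ /= x00]; rewrite -x00 eqxx in x0.
Qed.

Import HBNNSimple.

Lemma bochner_integral_scale (A : set W) (g : W -> R) (y : V) :
  measurable A -> (forall w, 0 <= g w) ->
  P.-integrable [set: W] (EFin \o g) ->
  is_bochner_integral P A (fun w => g w *: y)
    (fine (\int[P]_(w in A) (g w)%:E)%E *: y).
Proof.
move=> mA g0 ig.
have mg : measurable_fun setT (EFin \o g) by case/integrableP: ig.
have igA : P.-integrable A (EFin \o g) by exact: integrableS ig.
pose h n := nnsfun_approx measurableT mg n.
have hg n w : h n w <= g w.
  by rewrite -lee_fin /h nnsfun_approxE; apply: le_approx => // ? _; rewrite lee_fin.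
have mh n : measurable_fun setT (h n) by exact: measurable_funP.
have [_ dc1 dc2] : [/\ P.-integrable A (EFin \o g),
  (\int[P]_(w in A) `|(h n w)%:E - (g w)%:E|)%E @[n --> \oo] --> 0%E &
  (\int[P]_(w in A) (h n w)%:E)%E @[n --> \oo] -->
    (\int[P]_(w in A) (g w)%:E)%E].
  apply: (@dominated_convergence _ _ _ P A mA (fun n w => (h n w)%:E)
    (EFin \o g) (EFin \o g)) => //.
  - by move=> n; apply/measurable_EFinP; exact: (measurable_funS measurableT (@subsetT _ A) (mh n)).
  - exact: (measurable_funS measurableT (@subsetT _ A) mg).
  - apply: aeW => w _; apply: (cvg_nnsfun_approx measurableT mg) => // x _.
    by rewrite lee_fin.
  - apply: aeW => w n _ /=; rewrite lee_fin ger0_norm//; exact: hg.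
have sE n : (fun w => h n w *: y) = (fun r => `|r| *: y) \o h n.
  by apply/funext => w /=; rewrite ger0_norm.
have ss n : simple_element ((fun r => `|r| *: y) \o h n).
  apply: simple_element_comp; first exact: fimfunP.
  by move=> i; exact: measurable_sfunP.
exists (fun n w => h n w *: y); split.
- by move=> n; rewrite sE.
- have := cvgeZl (y := `|y|%:E) isT dc1.
  rewrite mule0; apply: cvg_trans; apply: near_eq_cvg; apply: nearW => n.
  rewrite -ge0_integralZl//; last first.
    apply: measurableT_comp => //; apply: emeasurable_funB.
      by apply/measurable_EFinP; exact: (measurable_funS measurableT (@subsetT _ A) (mh n)).
    exact: (measurable_funS measurableT (@subsetT _ A) mg).
  apply: eq_integral => w _.
  by rewrite -scalerBl normrZ distrC mulrC EFinM.
- suff E n : simple_integral P A (fun w => h n w *: y) =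
      fine (\int[P]_(w in A) (h n w)%:E)%E *: y.
    under eq_fun do rewrite E; apply: cvgZr_tmp; apply: fine_cvg.
    by rewrite fineK//; apply: integrable_fin_num.
  have /finite_seqP[r rE] := fimfunP (h n).
  rewrite sE (@simple_integral_comp _ (h n) _ (undup r)) ?undup_uniq//; last first.
    move=> w; rewrite mem_undup.
    by have : range (h n) (h n w) by [exists w]; rewrite rE.
  rewrite (eq_integral (fun w => (`|h n w|)%:E)); last first.
    by move=> w _; rewrite ger0_norm.
  rewrite (@integral_simple_comp _ (h n) (fun r => `|r|) (undup r)) ?undup_uniq//.
    by rewrite scaler_suml; apply: eq_bigr => i _; rewrite scalerA.
  move=> w; rewrite mem_undup.
  by have : range (h n) (h n w) by [exists w]; rewrite rE.
Qed.

(** Both an integrable element (with indicators for the g k) and its conditional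
    expectation (with their conditional probabilities) have this form, and the
    value of the integral involves the g k through their integrals over A only. *)
Lemma bochner_integral_series (A : set W) (f : W -> V) (g : nat -> W -> R)
    (y : nat -> V) :
  measurable A -> borel_fun f -> (forall k w, 0 <= g k w) ->
  (forall k, P.-integrable [set: W] (EFin \o g k)) ->
  (\sum_(k <oo) (\int[P]_(w in [set: W]) (g k w)%:E * `|y k|%:E) < +oo)%E ->
  (\int[P]_(w in [set: W]) `|f w - \sum_(k < n) g k w *: y k|%:E)%E
    @[n --> \oo] --> 0%E ->
  is_bochner_integral P A f
    (limn (fun n => \sum_(k < n) fine (\int[P]_(w in A) (g k w)%:E)%E *: y k)).
Proof.
move=> mA mf g0 ig gy ffn.
have mg k : measurable_fun setT (g k).
  by apply/measurable_EFinP; case/integrableP : (ig k).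
pose fn n w := \sum_(k < n) g k w *: y k.
have mfn n : borel_fun (fn n).
  apply: (@borel_fun_sum _ _ _ _ sepV n (fun k w => g k w *: y k)) => k.
  exact: borel_fun_scale.
pose c k := fine (\int[P]_(w in A) (g k w)%:E)%E.
have cE k : (c k)%:E = (\int[P]_(w in A) (g k w)%:E)%E.
  rewrite fineK//; apply: integrable_fin_num => //.
  exact: integrableS (ig k).
have c0 k : 0 <= c k by apply/fine_ge0/integral_ge0 => w _; rewrite lee_fin.
apply: (bochner_integral_lim (fn := fn)
  (vn := fun n => \sum_(k < n) c k *: y k)) => //.
- elim=> [|n IH].
    rewrite /fn big_ord0 (_ : (fun w => _) = fun=> 0).
      exact: bochner_integral0.
    by apply/funext => w; rewrite big_ord0.
  rewrite (_ : fn n.+1 = fun w => fn n w + g n w *: y n); last first.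
    by apply/funext => w; rewrite /fn big_ord_recr.
  rewrite big_ord_recr/=; apply: bochner_integralD => //.
    exact: borel_fun_scale.
  exact: bochner_integral_scale.
- apply: (squeeze_cvge _ (cvg_cst _) ffn); apply: nearW => n.
  rewrite L1dist_ge0/=; apply: ge0_subset_integral => //.
  exact: measurable_L1dist.
- suff : cvgn (series (fun k => c k *: y k)).
    rewrite /series/= => /cvgP; rewrite /fn.
    by under eq_fun do rewrite big_mkord.
  apply: normed_cvg.
  apply: (@nondecreasing_is_cvgn R).
    by apply: (@nondecreasing_series R (fun k => `|c k *: y k|) xpredT 0%N).
  exists (fine (\sum_(k <oo) (\int[P]_(w in [set: W]) (g k w)%:E * `|y k|%:E))%E).
  move=> _ [n _ <-]; rewrite -lee_fin fineK; last first.
    rewrite ge0_fin_numE//; apply: nneseries_ge0 => k _ _.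
    by apply: mule_ge0; rewrite ?lee_fin//; apply: integral_ge0 => w _; rewrite lee_fin.
  rewrite /series/= -sumEFin.
  apply: le_trans (nneseries_lim_ge n _); last first.
    move=> k _ _.
    by apply: mule_ge0; rewrite ?lee_fin//; apply: integral_ge0 => w _; rewrite lee_fin.
  apply: lee_sum => k _; rewrite normrZ ger0_norm// EFinM cE.
  apply: lee_wpmul2r; first by rewrite lee_fin.
  apply: ge0_subset_integral => //; first exact/measurable_EFinP.
  by move=> w _; rewrite lee_fin.
Qed.

End Bochner.

(** * Existence of conditional expectations *)

Section TraceMeasure.
Context {d : measure_display} {W : measurableType d} {R : realType}.
Variables (P : probability W R) (H : set (set W)) (B : set W).
Hypotheses (sH : sub_sigma_field H) (mB : measurable B).

Local Notation TH := (g_sigma_algebraType H).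

Lemma sub_measurableE : (measurable : set (set TH)) = H.
Proof. by apply: measurable_sub_sigma; case: sH. Qed.

Lemma sub_measurable (A : set TH) : measurable A -> measurable (A : set W).
Proof. by rewrite sub_measurableE; case: sH => _; apply. Qed.

Lemma measurable_fun_sub d' (T' : measurableType d') (f : W -> T') :
  measurable_fun [set: TH] (f : TH -> T') -> measurable_fun [set: W] f.
Proof.
move=> mf _ Y mY; have := mf measurableT Y mY.
by rewrite !setTI => /sub_measurable.
Qed.

Lemma measurable_id_sub : measurable_fun [set: W] (id : W -> TH).
Proof. by move=> _ Y mY; rewrite setTI; exact: sub_measurable. Qed.

(** The identity as a map onto W with the smaller sigma-algebra: its law is the
    restriction of P to H. *)
Definition sub_id : {mfun W >-> TH} := mfun_Sub (mem_set measurable_id_sub).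

(** The measurability proofs are arguments so that the measure structure can be
    inferred from the term. *)
Definition trace_measure & measurable B & sub_sigma_field H : set TH -> \bar R :=
  fun A => P (A `&` B).

Local Notation nu := (trace_measure mB sH).

Let nu0 : nu set0 = 0%E.
Proof. by rewrite /trace_measure set0I measure0. Qed.

Let nu_ge0 A : (0 <= nu A)%E.
Proof. exact: measure_ge0. Qed.

Let nu_sigma_additive : semi_sigma_additive nu.
Proof.
move=> F mF tF mUF; rewrite /trace_measure setI_bigcupl.
have mFB i : @measurable _ W (F i `&` B).
  by apply: measurableI => //; exact: (sub_measurable (mF i)).
apply: measure_semi_sigma_additive => //; first exact: trivIset_setIr.
exact: bigcupT_measurable.
Qed.

HB.instance Definition _ := isMeasure.Build _ _ _ nu nu0 nu_ge0 nu_sigma_additive.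

Let nu_fin : fin_num_fun nu.
Proof.
by move=> A mA; apply: fin_num_measure; apply: measurableI => //;
  exact: (sub_measurable mA).
Qed.

HB.instance Definition _ := @Measure_isFinite.Build _ _ _ nu nu_fin.

Lemma ge0_integral_sub (A : set W) (f : W -> \bar R) :
  H A -> measurable_fun [set: TH] (f : TH -> \bar R) -> (forall w, 0 <= f w)%E ->
  (\int[distribution P sub_id]_(w in A) f w = \int[P]_(w in A) f w)%E.
Proof.
move=> HA mf f0; rewrite /distribution ge0_integral_pushforward//.
- by rewrite sub_measurableE.
- exact: measurable_funTS.
Qed.

(** The Radon-Nikodym density, relative to H, of the trace of P on B. *)
Lemma cond_probability : exists g : W -> R,
  [/\ measurable_fun [set: TH] (g : TH -> R), forall w, 0 <= g w &
      forall A, H A -> (\int[P]_(w in A) (g w)%:E = P (A `&` B))%E].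
Proof.
have dom : nu `<< distribution P sub_id.
  move=> N N0 A mA AN; apply/eqP; rewrite eq_le measure_ge0 andbT.
  have <- : distribution P sub_id A = 0%E by exact: N0.
  apply: le_measure; rewrite ?inE//.
    by apply: measurableI => //; exact: (sub_measurable mA).
  exact: (sub_measurable mA).
have [f0 ff fi fE] := And4 (Radon_Nikodym_SigmaFinite.f_ge0 dom)
  (Radon_Nikodym_SigmaFinite.f_fin_num dom)
  (Radon_Nikodym_SigmaFinite.f_integrable dom)
  (Radon_Nikodym_SigmaFinite.f_integral dom).
move: (Radon_Nikodym_SigmaFinite.f _ _) f0 ff fi fE => f f0 ff fi fE.
have mf : measurable_fun [set: TH] f by case/integrableP : fi.
exists (fun w => fine (f w)); split.
- by apply: (@measurableT_comp _ _ _ TH _ _ fine _ f) => //; exact: fine_measurable.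
- by move=> w; apply: fine_ge0.
- move=> A HA; transitivity (\int[P]_(w in A) f w)%E.
    by apply: eq_integral => w _; rewrite fineK.
  by rewrite -ge0_integral_sub// -fE// sub_measurableE.
Qed.

End TraceMeasure.

Section CondExpectation.
Context {d : measure_display} {W : measurableType d} {R : realType}
  {V : completeNormedModType R}.
Variable P : probability W R.
Hypothesis sepV : separable_space V.

(** Greedy algorithm: from the current remainder r n subtract the point y n of the
    dense sequence on the set where r n is within a third of the norm of y n of
    it.  This lowers the norm of the remainder by at least a third of that of
    y n, whence the summability.  Every point of the dense sequence is proposed
    infinitely often; a nonzero limit of the remainders would be close to one
    of them, which would be subtracted again and again. *)
Lemma atomic_decomposition (f : W -> V) : borel_fun f ->
  exists (B : nat -> set W) (y : nat -> V),
    [/\ forall k, measurable (B k),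
        forall w n, `|f w - \sum_(k < n) \1_(B k) w *: y k| <= `|f w|,
        forall w n, \sum_(k < n) \1_(B k) w * `|y k| <= 3 * `|f w| &
        forall w, \sum_(k < n) \1_(B k) w *: y k @[n --> \oo] --> f w].
Proof.
move=> mf; have [q dq] := dense_sequence sepV.
pose y n := q (pair_row n).
pose good n (r : W -> V) : set W := [set w | `|r w - y n| < `|y n| / 3].
pose fix r n : W -> V :=
  if n is m.+1 then fun w => r m w - \1_(good m (r m)) w *: y m else f.
pose B n := good n (r n).
have goodE n w : \1_(B n) w = if `|r n w - y n| < `|y n| / 3 then 1 else 0 :> R.
  rewrite indicE; case: ifPn => h; first by rewrite mem_set.
  by rewrite memNset//; apply/negP.
have dec n w : `|r n.+1 w| <= `|r n w| - \1_(B n) w * (`|y n| / 3).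
  rewrite [r n.+1 w]/= -/(B n) goodE; case: ltP => rB.
    rewrite scale1r mul1r.
    have := ler_normB (r n w) (r n w - y n); rewrite opprB addrC subrK.
    have ar (a b c : R) : a < b / 3 -> b <= c + a -> a <= c - b / 3 by lra.
    exact: ar.
  by rewrite scale0r mul0r !subr0.
have sumE n w : r n w = f w - \sum_(k < n) \1_(B k) w *: y k.
  elim: n => [|n IH]; first by rewrite big_ord0 subr0.
  by rewrite big_ord_recr /= -/(B n) IH opprD addrA.
have bound n w : `|r n w| + (\sum_(k < n) \1_(B k) w * `|y k|) / 3 <= `|f w|.
  elim: n => [|n IH]; first by rewrite big_ord0 mul0r addr0.
  apply: le_trans IH; rewrite big_ord_recr/= mulrDl addrA.
  have := dec n w; rewrite mulrA.
  have ar (a b c s : R) : a <= b - c -> a + s + c <= b + s by lra.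
  exact: ar.
have mrB n : borel_fun (r n) /\ measurable (B n).
  have mB (h : W -> V) : borel_fun h -> measurable (good n h).
    move=> mh; apply: measurable_lt_set; last exact: measurable_cst.
    exact: ((borel_funP _ sepV).1 mh).
  elim: n mB => [|n IH] mB; first by split => //; exact: mB.
  suff mr : borel_fun (r n.+1) by split=> //; exact: mB.
  have [mrn mBn] := IH ltac:(move=> h mh; apply: measurable_lt_set;
    [exact: ((borel_funP _ sepV).1 mh)|exact: measurable_cst]).
  rewrite (_ : r n.+1 = fun w => r n w + \1_(B n) w *: (- y n)).
    apply: borel_funD => //; apply: borel_fun_scale.
    exact: measurable_indic.
  by apply/funext => w /=; rewrite scalerN.
have ar3 (a b s : R) : 0 <= a -> a + s / 3 <= b -> s <= 3 * b by lra.
exists B, y; split.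
- by move=> k; case: (mrB k).
- move=> w n; rewrite -sumE; apply: le_trans (bound n w).
  rewrite lerDl; apply: divr_ge0 => //; apply: sumr_ge0 => k _.
  by apply: mulr_ge0 => //; rewrite indicE.
- by move=> w n; exact: ar3 (normr_ge0 _) (bound n w).
move=> w.
have cS : cvgn (series (fun k => \1_(B k) w *: y k)).
  apply: normed_cvg; apply: (@nondecreasing_is_cvgn R).
    by apply: (@nondecreasing_series R (fun k => `|\1_(B k) w *: y k|) xpredT 0%N).
  exists (3 * `|f w|) => _ [n _ <-]; rewrite /=; rewrite seriesEord/=.
  under eq_bigr => k _ do (rewrite normrZ ger0_norm; last by rewrite indicE).
  exact: ar3 (normr_ge0 _) (bound n w).
have cs : \sum_(k < n) \1_(B k) w *: y k @[n --> \oo] -->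
    limn (series (fun k => \1_(B k) w *: y k)).
  have -> : (fun n => \sum_(k < n) \1_(B k) w *: y k) =
      series (fun k => \1_(B k) w *: y k).
    by apply/funext => n; rewrite /series/= big_mkord.
  exact: cS.
move: (limn _) cs => l cs.
suff -> : f w = l by [].
apply: contrapT => fl; pose x := f w - l.
have x0 : 0 < `|x| by rewrite normr_gt0 subr_eq0; apply/eqP.
have rx : r n w @[n --> \oo] --> x.
  under eq_fun do rewrite sumE.
  by apply: cvgB => //; exact: cvg_cst.
have [j xj] := dq x (`|x| / 8) ltac:(by rewrite divr_gt0).
have qj : `|x| * (7 / 8) <= `|q j|.
  have := ler_normD (x - q j) (q j); rewrite subrK.
  have ar (a b c : R) : a < c / 8 -> c <= a + b -> c * (7 / 8) <= b by lra.
  exact: ar.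
have x8 : 0 < `|x| / 8 by rewrite divr_gt0.
move/cvgrPdist_lt : rx => /(_ _ x8)[N _ Nr].
pose n := pair_code j N.
have Nn : (N <= n)%N by exact: pair_code_ge.
have yn : y n = q j by rewrite /y /n pair_rowK.
have rn := Nr n Nn; have rn1 := Nr n.+1 (leqW Nn).
have inB : `|r n w - y n| < `|y n| / 3.
  rewrite yn -(subrKA x).
  apply: le_lt_trans (ler_normD _ _) _; rewrite distrC.
  have ar (a b c e : R) : 0 < e -> a < e / 8 -> b < e / 8 -> e * (7 / 8) <= c ->
    a + b < c / 3 by lra.
  exact: ar x0 rn xj qj.
have : `|y n| <= `|x - r n w| + `|x - r n.+1 w|.
  rewrite [r n.+1 w]/= -/(B n) goodE inB scale1r.
  rewrite (distrC x (r n w)) [X in _ <= _ + X](_ : _ = `|y n - (r n w - x)|).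
    by apply: le_trans (ler_normD _ _); rewrite addrC subrK.
  by rewrite !opprB addrCA.
rewrite yn; apply/negP; rewrite -ltNge.
have ar (a b c e : R) : 0 < e -> a < e / 8 -> b < e / 8 -> e * (7 / 8) <= c ->
  a + b < c by lra.
exact: ar x0 rn rn1 qj.
Qed.


Lemma bochner_integrable_norm (f : W -> V) :
  bochner_integrable P f <->
  borel_fun f /\ (\int[P]_(w in [set: W]) `|f w|%:E < +oo)%E.
Proof.
split=> [[/random_element_measurableE mf /integrableP[_ fi]]|[mf fi]].
  by split=> //; move: fi; under eq_integral do rewrite gee0_abs ?lee_fin//.
split; first exact/random_element_measurableE.
apply/integrableP; split; first exact/measurable_EFinP/borel_fun_norm.
by under eq_integral do rewrite gee0_abs ?lee_fin//.
Qed.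

Lemma scaled_integral (g : W -> R) (c : R) : measurable_fun setT g ->
  (forall w, 0 <= g w) -> 0 <= c ->
  (\int[P]_(w in [set: W]) (g w * c)%:E =
   \int[P]_(w in [set: W]) (g w)%:E * c%:E)%E.
Proof.
move=> mg g0 c0; under eq_integral do rewrite mulrC EFinM.
rewrite ge0_integralZl ?lee_fin//; first by rewrite muleC.
- exact/measurable_EFinP.
- by move=> w _; rewrite lee_fin.
Qed.

(** The tail is an extended real, so that it can be integrated as a series of
    nonnegative functions. *)
Lemma series_tail_bound (g : nat -> R) (y : nat -> V) :
  (forall k, 0 <= g k) -> (\sum_(k <oo) (g k * `|y k|)%:E < +oo)%E ->
  cvgn (fun n => \sum_(k < n) g k *: y k) /\
  forall n, (`|limn (fun n => \sum_(k < n) g k *: y k) - \sum_(k < n) g k *: y k|%:E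
    <= \sum_(n <= k <oo) (g k * `|y k|)%:E)%E.
Proof.
move=> g0 gy.
have gy0 k : (0%:E <= (g k * `|y k|)%:E)%E by rewrite lee_fin mulr_ge0.
have cS : cvgn (fun n => \sum_(k < n) g k *: y k).
  have -> : (fun n => \sum_(k < n) g k *: y k) = series (fun k => g k *: y k).
    by apply/funext => n; rewrite seriesEord.
  apply: normed_cvg; apply: (@nondecreasing_is_cvgn R).
    by apply: (@nondecreasing_series R (fun k => `|g k *: y k|) xpredT 0%N).
  exists (fine (\sum_(k <oo) (g k * `|y k|)%:E)%E) => _ [n _ <-].
  rewrite /= -lee_fin fineK ?ge0_fin_numE//; last exact: nneseries_ge0.
  apply: le_trans (nneseries_lim_ge n _); last by move=> k _ _; exact: gy0.
  rewrite /series/= -sumEFin; apply: lee_sum => k _.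
  by rewrite normrZ ger0_norm.
split=> // n.
have cl : `|\sum_(k < m) g k *: y k - \sum_(k < n) g k *: y k|%:E @[m --> \oo] -->
    `|limn (fun n => \sum_(k < n) g k *: y k) - \sum_(k < n) g k *: y k|%:E.
  apply: cvg_EFin; first exact: nearW.
  by apply: cvg_norm; apply: cvgB => //; exact: cvg_cst.
apply: (cvge_to_le cl); exists n => // m /= nm.
rewrite -!(big_mkord xpredT (fun k => g k *: y k)) (big_cat_nat (leq0n n) nm)//=.
rewrite addrAC subrr add0r.
apply: le_trans (nneseries_lim_ge m _); last by move=> k _ _; exact: gy0.
rewrite sumEFin lee_fin; apply: le_trans (ler_norm_sum _ _ _) _.
by apply: ler_sum => k _; rewrite normrZ ger0_norm.
Qed.

(** With f the sum of the atoms y k on B k, the candidate is the sum of the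
    g k *: y k, where g k is the conditional probability of B k.  It converges
    almost surely, and in L1, since the integrals of the g k times the norms of
    the y k are those of the atoms. *)
Lemma cond_expectation_exists (H : set (set W)) (f : W -> V) :
  sub_sigma_field H -> bochner_integrable P f ->
  exists e, is_cond_expectation P H f e.
Proof.
move=> sH bf; have /bochner_integrable_norm[mf fi] := bf.
have [B [y [mB fB yB cB]]] := atomic_decomposition mf.
have : forall k, exists g : W -> R,
  [/\ measurable_fun [set: g_sigma_algebraType H] (g : g_sigma_algebraType H -> R),
    forall w, 0 <= g w &
    forall A, H A -> (\int[P]_(w in A) (g w)%:E = P (A `&` B k))%E].
  by move=> k; exact: cond_probability sH (mB k).
move=> /choice[g gP].
have mgH k : measurable_fun [set: g_sigma_algebraType H]
  (g k : g_sigma_algebraType H -> R) by case: (gP k).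
have mg k : measurable_fun [set: W] (g k) by exact: (measurable_fun_sub sH).
have g0 k w : 0 <= g k w by case: (gP k).
have HT : H setT by rewrite -(sub_measurableE sH); exact: measurableT.
have intg k : (\int[P]_(w in [set: W]) (g k w)%:E = P (B k))%E.
  by have [_ _ ->//] := gP k; rewrite setTI.
have igk k : P.-integrable [set: W] (EFin \o g k).
  apply/integrableP; split; first exact/measurable_EFinP.
  under eq_integral do rewrite gee0_abs ?lee_fin//.
  by rewrite intg (le_lt_trans (probability_le1 _ _))// ltry.
have iBk k : P.-integrable [set: W] (EFin \o (\1_(B k) : W -> R)).
  exact: integrable_indic.
have mBk k : measurable_fun [set: W] (\1_(B k) : W -> R) by exact: measurable_indic.
have PBy : (\sum_(k <oo) P (B k) * `|y k|%:E < +oo)%E.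
  apply: (@le_lt_trans _ _ (3%:E * \int[P]_(w in [set: W]) `|f w|%:E)%E); last first.
    by rewrite lte_mul_pinfty.
  apply: lime_le; first by apply: is_cvg_nneseries => k _ _; exact: mule_ge0.
  apply: nearW => n.
  rewrite -ge0_integralZl ?lee_fin//; last first.
    exact/measurable_EFinP/borel_fun_norm.
  have -> : (\sum_(0 <= k < n) P (B k) * `|y k|%:E =
      \int[P]_(w in [set: W]) \sum_(k < n) (\1_(B k) w * `|y k|)%:E)%E.
    rewrite ge0_integral_sum//.
    + rewrite big_mkord; apply: eq_bigr => k _.
      rewrite scaled_integral//.
      by rewrite integral_indic// setIT.
    + by move=> k; apply/measurable_EFinP; apply: measurable_funM => //; exact: measurable_cst.
  apply: ge0_le_integral => //.
  + by move=> w _; apply: sume_ge0 => k _; rewrite lee_fin mulr_ge0// indicE.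
  + apply: emeasurable_sum => k; apply/measurable_EFinP.
    by apply: measurable_funM => //; exact: measurable_cst.
  + by apply/measurable_EFinP; apply: measurable_funM => //; exact: borel_fun_norm.
  + by move=> w _; rewrite sumEFin -EFinM lee_fin.
pose G k w : \bar R := (g k w * `|y k|)%:E.
have G0 k w : (0 <= G k w)%E by rewrite lee_fin mulr_ge0.
have mG k : measurable_fun [set: W] (G k).
  by apply/measurable_EFinP; apply: measurable_funM => //; exact: measurable_cst.
have intG k : (\int[P]_(w in [set: W]) G k w = P (B k) * `|y k|%:E)%E.
  by rewrite scaled_integral// intg.
have int_tail n : (\int[P]_(w in [set: W]) (\sum_(n <= k <oo) G k w) =
    \sum_(n <= k <oo) P (B k) * `|y k|%:E)%E.
  under eq_integral do rewrite -nneseries_addn//.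
  rewrite integral_nneseries//; under eq_eseriesr do rewrite intG.
  rewrite (@nneseries_addn _ (fun k => P (B k) * `|y k|%:E)%E n)// => k.
  exact: mule_ge0.
have mtail n : measurable_fun [set: W] (fun w => \sum_(n <= k <oo) G k w)%E.
  under eq_fun do rewrite -nneseries_addn//.
  exact: (@ge0_emeasurable_sum _ _ _ _ (fun k w => G (k + n)%N w) xpredT).
pose S w := (\sum_(0 <= k <oo) G k w)%E.
have S0 w : (0 <= S w)%E by apply: nneseries_ge0 => k _ _.
have mSH : measurable_fun [set: g_sigma_algebraType H]
    (S : g_sigma_algebraType H -> \bar R).
  apply: (@ge0_emeasurable_sum _ (g_sigma_algebraType H) _ _
    (fun k w => G k w) xpredT) => // k _.
  by apply/measurable_EFinP; apply: measurable_funM => //; exact: measurable_cst.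
have iS : P.-integrable [set: W] S.
  apply/integrableP; split; first exact: mtail.
  under eq_integral do rewrite gee0_abs//.
  by rewrite int_tail.
have aeS : {ae P, forall w, (S w < +oo)%E}.
  have := integrable_ae measurableT iS; apply: filterS => w /(_ I).
  by rewrite ge0_fin_numE.
pose Gd : set W := [set w | (S w < +oo)%E].
have mGd : @measurable _ (g_sigma_algebraType H) Gd.
  have := emeasurable_fun_infty_o measurableT mSH +oo%E.
  by rewrite setTI.
pose fn n w := \sum_(k < n) g k w *: y k.
pose e w := if `[< Gd w >] then limn (fun n => fn n w) else 0.
have mfnH n : measurable_fun [set: g_sigma_algebraType H]
    (fn n : g_sigma_algebraType H -> borelType V).
  apply: (@borel_fun_sum _ (g_sigma_algebraType H) _ _ sepV n (fun k w => g k w *: y k)) => k.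
  exact: borel_fun_scale.
have meH : measurable_fun [set: g_sigma_algebraType H]
    (e : g_sigma_algebraType H -> borelType V).
  apply: (@borel_fun_cvg _ (g_sigma_algebraType H) _ _ sepV
    (fun n w => if `[< Gd w >] then fn n w else 0)) => [n|w].
    by apply: measurable_fun_if_set.
  rewrite /e; case: asboolP => Gw; last exact: cvg_cst.
  by have [] := series_tail_bound (fun k => g0 k w) Gw.
have me : borel_fun e by exact: (measurable_fun_sub sH meH).
have mfn n : borel_fun (fn n) by exact: (measurable_fun_sub sH (mfnH n)).
have dist_tail n : (\int[P]_(w in [set: W]) `|e w - fn n w|%:E <=
    \sum_(n <= k <oo) P (B k) * `|y k|%:E)%E.
  rewrite -int_tail; apply: ae_ge0_le_integral => //.
  - exact: measurable_L1dist.
  - by move=> w _; apply: nneseries_ge0 => k _ _.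
  - move: aeS; apply: filterS => w Sw _; rewrite /e asboolT//.
    by have [_] := series_tail_bound (fun k => g0 k w) Sw; apply.
have be : bochner_integrable P e.
  apply/bochner_integrable_norm; split=> //.
  apply: le_lt_trans PBy; apply: le_trans (dist_tail 0%N).
  by under [leRHS]eq_integral do rewrite /fn big_ord0 subr0.
exists e; split => // A HA.
have mA : measurable (A : set W) by case: sH => _; apply.
exists (limn (fun n => \sum_(k < n) fine (\int[P]_(w in A) (g k w)%:E)%E *: y k)).
  under eq_fun => n do under eq_bigr => k _ do
    (rewrite (_ : (\int[P]_(w in A) (g k w)%:E = \int[P]_(w in A) (\1_(B k) w)%:E)%E);
     last by rewrite integral_indic//; have [_ _ ->//] := gP k; rewrite setIC).
  apply: (@bochner_integral_series _ _ _ _ P sepV A f (fun k => \1_(B k)) y) => //.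
  - under eq_eseriesr do rewrite integral_indic// setIT.
    exact: PBy.
  - pose rn n w := (`|f w - \sum_(k < n) \1_(B k) w *: y k|)%:E.
    have mrn n : measurable_fun [set: W] (rn n).
      apply: measurable_L1dist => //.
      apply: (@borel_fun_sum _ _ _ _ sepV n (fun k w => \1_(B k) w *: y k)) => k.
      exact: borel_fun_scale.
    have rn0 : {ae P, forall w, setT w -> rn n w @[n --> \oo] --> 0%E}.
      apply: aeW => w _; apply: cvg_EFin; first exact: nearW.
      rewrite [X in _ --> X](_ : _ = `|f w - f w|); last by rewrite subrr normr0.
      by apply: cvg_norm; apply: cvgB; [exact: cvg_cst|exact: cB].
    have rnf : {ae P, forall w n, setT w -> (`|rn n w| <= `|f w|%:E)%E}.
      by apply: aeW => w n _; rewrite gee0_abs ?lee_fin.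
    have [_ _] := dominated_convergence measurableT mrn (measurable_cst _)
      rn0 bf.2 rnf.
    by rewrite integral0.
apply: (@bochner_integral_series _ _ _ _ P sepV A e g y) => //.
- by under eq_eseriesr do rewrite intg.
- have PB0 k : xpredT k -> (0 <= P (B k) * `|y k|%:E)%E by move=> _; exact: mule_ge0.
  have tl := nneseries_tail_cvg PBy PB0.
  apply: (squeeze_cvge _ (cvg_cst _) tl); apply: nearW => n.
  by rewrite dist_tail andbT L1dist_ge0.
Qed.

End CondExpectation.

(** * Conditional expectations and convex random sets *)

(** Zero weights are allowed because the sums will run over a fixed family of
    balls, some of which receive no mass and have no point of C attached. *)
Lemma convex_set_sum (R : realType) (V : normedModType R) (C : set V)
    (n : nat) (p : nat -> R) (x : nat -> V) :
  convex_set C -> (forall k, 0 <= p k) -> (forall k, (k < n)%N -> 0 < p k -> C (x k)) ->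
  0 < \sum_(k < n) p k ->
  C ((\sum_(k < n) p k)^-1 *: \sum_(k < n) p k *: x k).
Proof.
move=> cC p0; elim: n => [|n IH] Cx; first by rewrite big_ord0 ltxx.
rewrite !big_ord_recr/=; set s := \sum_(k < n) p k; move=> sp0.
have s0 : 0 <= s by exact: sumr_ge0.
have Cx' k : (k < n)%N -> 0 < p k -> C (x k) by move=> kn; apply/Cx/ltnW.
have [pn|pn] := leP (p n) 0.
  have {}pn : p n = 0 by apply/eqP; rewrite eq_le pn p0.
  by rewrite pn addr0 scale0r addr0; apply: IH => //; move: sp0; rewrite pn addr0.
have [s_le|s_gt] := leP s 0.
  have {}s_eq : s = 0 by apply/eqP; rewrite eq_le s_le s0.
  have -> : \sum_(k < n) p k *: x k = 0.
    rewrite big1// => k _; suff -> : p k = 0 by rewrite scale0r.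
    apply/eqP; rewrite eq_le p0 andbT -s_eq /s (bigD1 k)//= lerDl.
    exact: sumr_ge0.
  rewrite s_eq !add0r scalerA mulVf ?gt_eqF// scale1r.
  exact: Cx.
have l01 : 0 <= s / (s + p n) <= 1.
  apply/andP; split; first by apply: divr_ge0 => //; exact: ltW.
  by rewrite ler_pdivrMr// mul1r lerDl.
have := cC (s^-1 *: \sum_(k < n) p k *: x k) (x n)
  (Itv01 (proj1 (andP l01)) (proj2 (andP l01))).
rewrite !inE => /(_ (IH Cx' s_gt) (Cx _ (ltnSn n) pn)).
suff -> : conv (Itv01 (proj1 (andP l01)) (proj2 (andP l01)))
    (s^-1 *: (\sum_(k < n) p k *: x k) : convex_lmodType V)
    (x n : convex_lmodType V) =
  (s + p n)^-1 *: (\sum_(k < n) p k *: x k + p n *: x n) by [].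
rewrite /conv/= /unstable.onem scalerA mulrAC divff ?gt_eqF// mul1r scalerDr scalerA.
congr (_ + _ *: _); apply: (mulIf (lt0r_neq0 sp0)).
by rewrite mulrBl mul1r divfK ?gt_eqF// [RHS]mulrAC mulVf ?gt_eqF// mul1r [LHS]addrC addKr.
Qed.

Lemma closed_approx (R : realType) (V : normedModType R) (C : set V) (y : V) :
  closed C -> (forall n, exists2 x, C x & `|x - y| < n.+1%:R^-1) -> C y.
Proof.
move=> cC Cy; apply: cC => U /nbhs_ballP[e /= e0 eU].
have [n ne] := exists_invS_lt e0; have [x Cx xy] := Cy n.
exists x; split=> //; apply: eU; rewrite -ball_normE /= distrC.
exact: lt_trans ne.
Qed.

Section SubSigmaSelection.
Context {d : measure_display} {W : measurableType d} {R : realType}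
  {V : completeNormedModType R}.
Variables (P : probability W R) (H : set (set W)).
Hypotheses (sepV : separable_space V) (sH : sub_sigma_field H).
Local Notation TH := (g_sigma_algebraType H).

Lemma negligible_sub (N : set W) :
  (distribution P (sub_id sH)).-negligible N -> P.-negligible N.
Proof. by move=> [A [mA PA NA]]; exists A; split=> //; exact: (sub_measurable sH mA). Qed.

(** Selection relative to H; P-null sets of H are null for P. *)
Lemma random_set_selection (D : set (TH * borelType V)) : measurable D ->
  exists (A : set W) (zeta : W -> V), [/\ H A, random_element H zeta,
    forall w, A w -> D (w, zeta w) &
    {ae P, forall w, (exists x, D (w, x)) -> A w}].
Proof.
move=> mD.
have [A [z [mA mz Dz nA]]] := measurable_selection (distribution P (sub_id sH)) sepV mD.
exists A, z; split=> //; first by rewrite -(sub_measurableE sH).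
apply: negligibleS (negligible_sub nA) => w /=.
by move=> /not_implyP[].
Qed.

Lemma random_set_near (M : W -> set V) (f : W -> V) (e : R) :
  random_set H M -> random_element H f ->
  measurable ([set p | M p.1 p.2 /\ `|p.2 - f p.1| < e] : set (TH * borelType V)).
Proof.
move=> mM mf; rewrite (_ : [set p | _] =
  [set p | M p.1 p.2] `&` [set p : TH * borelType V | `|(p.2 : V) - f p.1| < e]).
  apply: measurableI => //; apply: measurable_lt_set; last exact: measurable_cst.
  apply: (@measurable_fun_dist _ (TH * borelType V)%type R V sepV snd (f \o fst)).
    exact: measurable_snd.
  exact: (measurableT_comp mf measurable_fst).
by apply/seteqP; split.
Qed.

End SubSigmaSelection.

Section Jensen.
Context {d : measure_display} {W : measurableType d} {R : realType}
  {V : completeNormedModType R}.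
Variables (P : probability W R) (H : set (set W)).
Hypotheses (sepV : separable_space V) (sH : sub_sigma_field H).
Local Notation TH := (g_sigma_algebraType H).

(** Otherwise the reverse inequalities on the fibers would add up. *)
Lemma exists_fiber_integral_lt (I : countType) (k : W -> I) (f : W -> \bar R)
    (c : R) (A : set W) :
  measurable A -> (forall i, measurable (k @^-1` [set i])) -> 0 <= c ->
  measurable_fun setT f -> (forall w, 0 <= f w)%E ->
  (\int[P]_(w in A) f w < c%:E * P A)%E ->
  exists i, (\int[P]_(w in A `&` k @^-1` [set i]) f w <
             c%:E * P (A `&` k @^-1` [set i]))%E.
Proof.
move=> mA mk c0 mf f0 fA; apply: contrapT => nex.
pose F n := A `&` [set w | pickle (k w) = n].
have Fge n : (c%:E * P (F n) <= \int[P]_(w in F n) f w)%E.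
  rewrite /F; case E : (unpickle n : option I) => [i|]; last first.
    rewrite (_ : _ `&` _ = set0) ?measure0 ?mule0 ?integral_set0//.
    by rewrite -subset0 => w [_ /= kn]; move: E; rewrite -kn pickleK.
  have [<-|nEi] := eqVneq (pickle i) n; last first.
    rewrite (_ : _ `&` _ = set0) ?measure0 ?mule0 ?integral_set0//.
    rewrite -subset0 => w [_ /= kn]; move: E; rewrite -kn pickleK => -[ki].
    by rewrite -ki kn eqxx in nEi.
  rewrite (_ : [set w | _] = k @^-1` [set i]).
    by rewrite leNgt; apply/negP => lt; apply: nex; exists i.
  apply/seteqP; split=> w /=; last by move=> ->.
  exact: (pcan_inj (@pickleK I)).
have mF n : measurable (F n).
  apply: measurableI => //.
  rewrite (_ : [set w | _] = \bigcup_(i : I) [set w | k w = i /\ pickle i = n]).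
    apply: countable_bigcupT_measurable => [|i]; first exact: countableP.
    have [<-|ne] := eqVneq (pickle i) n.
      rewrite (_ : [set w | _] = k @^-1` [set i])//.
      by apply/seteqP; split=> w /=; [case|].
    rewrite (_ : [set w | _] = set0)// -subset0 => w /= [_ E].
    by rewrite E eqxx in ne.
  apply/seteqP; split=> w /=; first by exists (k w).
  by move=> [i _ [<-]].
have AE : A = \bigcup_n F n.
  by apply/seteqP; split=> [w Aw|w [n _ []//]]; exists (pickle (k w)).
have tF : trivIset [set: nat] F.
  by move=> m n _ _ [w [[_ /= <-] [_ /= <-]]].
move: fA; apply/negP; rewrite -leNgt.
rewrite {2}AE ge0_integral_bigcup//; last first.
  exact: (measurable_funS measurableT (@subsetT _ _) mf).
have -> : P A = (\sum_(n <oo) P (F n))%E.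
  rewrite AE measure_bigcup//.
  by apply: eq_eseriesl => n; rewrite in_setT.
rewrite -nneseriesZl//.
by apply: lee_nneseries => [n _ _|n _]; [exact: mule_ge0|exact: Fge].
Qed.

Variables (M : W -> set V) (f e : W -> V) (B : set W).
Hypotheses (rM : random_set H M) (cvxM : as_convex P M)
  (ef : is_cond_expectation P H f e) (HB : H B)
  (fM : {ae P, forall w, B w -> M w (f w)}).

(** Averaging argument.  On a piece of positive probability where e is nearly q i
    and no A j with j < N separates points, the mean of e is near q i, and the mean
    of f is near a combination of those q k that are close to values of f, hence
    close to points of M w for every w of the piece.  The part of f in balls of
    index N and more enters through the integral of T N, which is small for N
    large. *)
Lemma cond_expectation_near (r : R) : 0 < r -> r <= 1 / 2 ->
  {ae P, forall w, B w -> exists2 x, M w x & `|x - e w| < 9 * r}.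
Proof.
move=> r0 r1; have ar1 (x y z g h : R) : x <= y + z -> y <= g + h -> z < r ->
  x <= r + (g + h + 1) by lra.
have ar2 (x y t a : R) : t < r * a -> x <= r * a -> y <= r * a + t ->
  x + y <= 3 * r * a by rewrite -mulrA; lra.
have ar3 (x t b L : R) (a : R) : x <= t -> t < b -> b <= a / 2 -> L + x = a ->
  a / 2 < L by lra.
have ar4 (x y : R) : x <= 6 * r -> y < r -> 0 < r -> r + (x + y) < 9 * r by lra.
have [bf be re fe] := ef.
have FF : Filter (almost_everywhere P) by exact: _.
have [mf fi] := (bochner_integrable_norm P sepV f).1 bf.
have [me ei] := (bochner_integrable_norm P sepV e).1 be.
have [q dq] := dense_sequence sepV.
have HT (A : set W) : H A -> measurable A by case: sH => _; apply.
have HTH (A : set W) : @measurable _ TH A -> H A by rewrite (sub_measurableE sH).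
have THH (A : set W) : H A -> @measurable _ TH A by rewrite (sub_measurableE sH).
(* up to a null set, A1 is where M comes within 9 * r of e; if A0 had positive
   probability, one of its points would belong to A1 *)
have [A1 [z1 [HA1 _ zA1 A1P]]] := random_set_selection P sepV sH
  (random_set_near sepV (9 * r) rM re).
pose A0 := B `\` A1.
have HA0 : H A0 by apply: HTH; apply: measurableD; exact: THH.
have mA0 := HT _ HA0.
suff PA0 : P A0 = 0%E.
  have A0P : {ae P, forall w, ~ A0 w} by exists A0; split=> // w /= /contrapT.
  move: A0P; apply: filterS => w nA0w Bw.
  have /zA1[/=] : A1 w by apply: contrapT => nA1; apply: nA0w.
  by exists (z1 w).
apply: contrapT => /eqP PA0.
have {}PA0 : (0 < P A0)%E by rewrite lt0e PA0 measure_ge0.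
(* A j belongs to H although f is not H-measurable: up to null sets, it is where
   M meets the ball around q j *)
have : forall j, exists A, [/\ H A,
    forall w, A w -> exists2 x, M w x & `|x - q j| < r &
    {ae P, forall w, M w (f w) -> `|f w - q j| < r -> A w}].
  move=> j; have [A [z [HA _ zA AP]]] := random_set_selection P sepV sH
    (random_set_near sepV r rM (@measurable_cst _ _ TH (borelType V) setT (q j))).
  exists A; split=> //; first by move=> w /zA[] /=; exists (z w).
  apply: (filterS _ AP) => w {}AP Mf fq; apply: AP.
  by exists (f w).
move=> /choice[A AP].
have mEf j : measurable [set w | `|f w - q j| < r].
  by apply: measurable_lt_set; [exact: ((borel_funP _ sepV).1 mf)|exact: measurable_cst].
have mEe i : @measurable _ TH [set w | `|e w - q i| < r].
  by apply: (@measurable_lt_set _ TH); [exact: ((borel_funP _ sepV).1 re)|exact: measurable_cst].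
have [J [mJ JP]] := measurable_first mEf.
have {}JP w : `|f w - q (J w)| < r.
  by have [j fj] := dq (f w) r r0; have [] := JP w (ex_intro _ j fj).
have [I [mI IP]] := measurable_first mEe.
have {}IP w : `|e w - q (I w)| < r.
  by have [j fj] := dq (e w) r r0; have [] := IP w (ex_intro _ j fj).
pose T N w : R := \1_[set w | (N <= J w)%N] w * (`|f w| + `|e w| + 1).
have mJN N : measurable [set w | (N <= J w)%N].
  rewrite (_ : [set w | _] = \bigcup_(j in [set j | (N <= j)%N]) J @^-1` [set j]).
    exact: bigcup_measurable.
  apply/seteqP; split=> [w Nw|w [j Nj Jw]]; first by exists (J w).
  by rewrite /= (Jw : J w = j).
have mT N : measurable_fun setT (T N).
  apply: measurable_funM; first exact: measurable_indic.
  apply: measurable_funD; last exact: measurable_cst.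
  by apply: measurable_funD; exact: borel_fun_norm.
have T0 N w : 0 <= T N w by rewrite mulr_ge0// ?indicE// !addr_ge0.
have mTop : P.-integrable [set: W] (fun w => (`|f w| + `|e w| + 1)%:E).
  have i1 : P.-integrable [set: W] (fun w => `|f w|%:E + `|e w|%:E)%E.
    by apply: integrableD => //; [exact: bf.2|exact: be.2].
  have i2 : P.-integrable [set: W] (fun _ => 1%:E) by exact: finite_measure_integrable_cst.
  by have := integrableD measurableT i1 i2; apply: eq_integrable.
have [N TN] : exists N, (\int[P]_(w in [set: W]) (T N w)%:E < r%:E * P A0)%E.
  have T_cvg : {ae P, forall w, setT w -> (T N w)%:E @[N --> \oo] --> 0%E}.
    apply: aeW => w _; apply: cvg_EFin; first exact: nearW.
    apply: (cvg_near_cst 0); exists (J w).+1 => // n /= Jn.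
    by rewrite /T indicE memNset ?mul0r//= => Jn'; move: Jn; rewrite ltnNge Jn'.
  have T_dom : {ae P, forall w n, setT w ->
      (`|(T n w)%:E| <= (`|f w| + `|e w| + 1)%:E)%E}.
    apply: aeW => w n _; rewrite gee0_abs lee_fin; last exact: T0.
    apply: ler_piMl; first by rewrite !addr_ge0.
    by rewrite indicE; case: (_ \in _).
  have mTE n : measurable_fun [set: W] (fun w => (T n w)%:E) by exact/measurable_EFinP.
  have [_ _] := dominated_convergence measurableT mTE (measurable_cst _)
    T_cvg mTop T_dom.
  rewrite integral0 => cT.
  have : nbhs (0 : \bar R) [set x | (x < r%:E * P A0)%E].
    apply: open_nbhs_nbhs; split; first exact: open_ereal_lt_ereal.
    by rewrite /= mule_gt0.
  by move=> /cT[N _ /(_ N (leqnn N)) TN]; exists N.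
have {}TN : (\int[P]_(w in A0) (T N w)%:E < r%:E * P A0)%E.
  apply: le_lt_trans TN; apply: ge0_subset_integral => //.
    exact/measurable_EFinP.
  by move=> w _; rewrite lee_fin.
(* a piece on which e is nearly constant and no A j splits *)
pose bits n w := mkseq (fun j => `[< A j w >]) n.
have mbits n b : @measurable _ TH [set w | bits n w = b].
  elim: n b => [|n IH] b.
    have [->|nb] := pselect (b = [::]).
      by rewrite (_ : [set w | _] = setT)//; apply/seteqP; split.
    by rewrite (_ : [set w | _] = set0)// -subset0 => w /= h; apply: nb.
  case/lastP: b => [|b x].
    rewrite (_ : [set w | _] = set0)// -subset0 => w /= /(congr1 size).
    by rewrite size_mkseq.
  rewrite (_ : [set w | _] = [set w | bits n w = b] `&` [set w | `[< A n w >] = x]).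
    apply: measurableI; first exact: IH.
    have mAn : @measurable _ TH (A n) by apply: THH; case: (AP n).
    case: x.
      rewrite (_ : [set w | _] = A n)//.
      by apply/seteqP; split=> w /=; [move/asboolP|move=> ?; apply/asboolP].
    rewrite (_ : [set w | _] = ~` A n); first exact: measurableC.
    by apply/seteqP; split=> w /=; [move/negbT/asboolPn|move=> ?; apply/negbTE/asboolPn].
  apply/seteqP; split=> w /=; rewrite /bits mkseqS.
    by move=> /rcons_inj[-> ->].
  by move=> [-> ->].
pose kap w := (I w, bits N w).
have mkap t : @measurable _ TH (kap @^-1` [set t]).
  case: t => i b; rewrite (_ : _ @^-1` _ = I @^-1` [set i] `&` [set w | bits N w = b]).
    by apply: measurableI; [exact: mI|exact: mbits].
  by apply/seteqP; split=> w /=; [case=> -> ->|case=> <- <-].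
have [[i b]] := exists_fiber_integral_lt mA0 (fun t => sub_measurable sH (mkap t))
  (ltW r0) ((measurable_EFinP _ _).2 (mT N)) (fun w => T0 N w) TN.
set A' := A0 `&` _ => TA'.
have HA' : H A' by apply: HTH; apply: measurableI; [exact: THH|exact: mkap].
have mA' := HT _ HA'.
have IA' w : A' w -> I w = i by move=> [_ []].
have bA' w1 w2 j : A' w1 -> A' w2 -> (j < N)%N -> A j w1 -> A j w2.
  move=> [_ [_ b1]] [_ [_ b2]] jN /asboolP Aj1; apply/asboolP.
  have : nth false (bits N w1) j = nth false (bits N w2) j by rewrite b1 b2.
  by rewrite /bits !nth_mkseq// Aj1 => <-.
have A'0 w : A' w -> A0 w by case.
move: A' {TN} TA' HA' mA' IA' bA' A'0 => A' TA' HA' mA' IA' bA' A'0.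
have [v fv ev] := fe A' HA'.
(* phi o u replaces f by the centre of its ball if the index of this ball is
   less than N, and by q i otherwise *)
pose u w := minn (J w) N; pose phi k := if (k < N)%N then q k else q i.
have uN w : u w \in index_iota 0 N.+1 by rewrite mem_index_iota ltnS geq_minr.
have muf k : measurable (u @^-1` [set k]).
  rewrite (_ : _ @^-1` _ = \bigcup_(j in [set j | minn j N = k]) J @^-1` [set j]).
    exact: bigcup_measurable.
  apply/seteqP; split=> [w uw|w [j jk Jw]]; first by exists (J w).
  by rewrite /= /u (Jw : J w = j).
have finu : finite_set (range u).
  by apply: (sub_finite_set _ (finite_seq (index_iota 0 N.+1))) => _ [w _ <-]; exact: uN.
have s1 : simple_element (phi \o u) by exact: simple_element_comp.
have s2 : simple_element ((fun=> q i) \o u) by exact: simple_element_comp.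
pose p k := fine (P (A' `&` u @^-1` [set k])).
have p0 k : 0 <= p k by exact: fine_ge0.
pose a := fine (P A'); have aE : P A' = a%:E by rewrite fineK// fin_num_measure.
have intc c : (\int[P]_(w in A') c%:E = (c * a)%:E)%E.
  by rewrite integral_cst// EFinM; congr (_ * _)%E; exact: aE.
pose t := fine (\int[P]_(w in A') (T N w)%:E)%E.
have Tfin : (\int[P]_(w in A') (T N w)%:E)%E \is a fin_num.
  rewrite ge0_fin_numE; last by apply: integral_ge0 => w _; rewrite lee_fin.
  by apply: lt_trans TA' _; rewrite aE -EFinM ltry.
have tE : (\int[P]_(w in A') (T N w)%:E)%E = t%:E by rewrite fineK.
have ta : t < r * a by move: TA'; rewrite tE aE -EFinM lte_fin.
have t0 : 0 <= t by apply/fine_ge0/integral_ge0 => w _; rewrite lee_fin.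
have a0 : 0 < a by rewrite -(pmulr_rgt0 _ r0); exact: le_lt_trans ta.
have sum_p : \sum_(k < N.+1) p k = a.
  have := @integral_simple_comp _ W R P nat u (fun=> 1) (index_iota 0 N.+1) A'
    (iota_uniq _ _) uN muf mA' (fun=> ler01).
  rewrite integral_cst// mul1e => /(etrans (esym aE)) [->]; rewrite big_mkord.
  by apply: eq_bigr => k _; rewrite mulr1.
have pN : p N <= t.
  rewrite -lee_fin -tE fineK; last by apply: fin_num_measure; exact: measurableI.
  apply: (@le_trans _ _ (\int[P]_(w in A' `&` u @^-1` [set N]) (T N w)%:E)%E).
    rewrite -[leLHS]mul1e -integral_cst; last exact: measurableI.
    apply: ge0_le_integral => //; first exact: measurableI.
    - by apply/measurable_EFinP; exact: (measurable_funS measurableT (@subsetT _ _) (mT N)).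
    - move=> w [_ /= uw]; rewrite lee_fin /T indicE mem_set/=; last first.
        by rewrite -[X in (X <= _)%N]uw geq_minl.
      by rewrite mul1r lerDr addr_ge0.
  apply: ge0_subset_integral => //; first exact: measurableI.
    by apply/measurable_EFinP; exact: (measurable_funS measurableT (@subsetT _ _) (mT N)).
  by move=> w _; rewrite lee_fin.
have d1 : `|v - \sum_(k < N.+1) p k *: phi k| <= r * a + t.
  have := bochner_integral_dist sepV mA' mf fv s1.
  rewrite (@simple_integral_comp _ _ _ _ P _ u phi (index_iota 0 N.+1) A'
    (iota_uniq _ _) uN muf mA') big_mkord => /le_trans le1.
  rewrite -lee_fin; apply: le1.
  apply: (@le_trans _ _ (\int[P]_(w in A') (r%:E + (T N w)%:E))%E).
    apply: ge0_le_integral => //.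
    - apply: measurable_L1dist => //; exact: simple_element_borel.
    - apply: emeasurable_funD => //.
      by apply/measurable_EFinP; exact: (measurable_funS measurableT (@subsetT _ _) (mT N)).
    - move=> w A'w; rewrite -EFinD lee_fin /= /phi /u /T indicE.
      have [JN|NJ] := ltnP (J w) N.
        rewrite JN memNset ?mul0r ?addr0; last first.
          by rewrite /= leqNgt JN.
        exact/ltW/JP.
      rewrite ltnn mem_set//= mul1r.
      have := IP w; rewrite (IA' w A'w).
      have := ler_normB (f w) (e w).
      have := ler_normD (f w - e w) (e w - q i); rewrite subrKA.
      exact: ar1.
  rewrite ge0_integralD//.
  - by rewrite intc tE -EFinD.
  - by move=> w _; rewrite lee_fin ltW.
  - by move=> w _; rewrite lee_fin.
  - by apply/measurable_EFinP; exact: (measurable_funS measurableT (@subsetT _ _) (mT N)).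
have d2 : `|v - \sum_(k < N.+1) p k *: q i| <= r * a.
  have := bochner_integral_dist sepV mA' me ev s2.
  rewrite (@simple_integral_comp _ _ _ _ P _ u (fun=> q i) (index_iota 0 N.+1) A'
    (iota_uniq _ _) uN muf mA') big_mkord => /le_trans le1.
  rewrite -lee_fin; apply: le1.
  rewrite -intc.
  apply: ge0_le_integral => //.
  - apply: measurable_L1dist => //; exact: simple_element_borel.
  - by move=> w A'w; rewrite lee_fin /= -(IA' w A'w); exact/ltW/IP.
have d3 : `|\sum_(k < N) p k *: (q k - q i)| <= 3 * r * a.
  have -> : \sum_(k < N) p k *: (q k - q i) =
      (v - \sum_(k < N.+1) p k *: q i) - (v - \sum_(k < N.+1) p k *: phi k).
    rewrite opprB addrC subrKA -sumrB big_ord_recr/= {2}/phi ltnn subrr addr0.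
    by apply: eq_bigr => k _; rewrite /phi ltn_ord scalerBr.
  apply: le_trans (ler_normB _ _) _.
  exact: ar2 ta d2 d1.
pose L := \sum_(k < N) p k.
have La : a / 2 < L.
  have ra : r * a <= a / 2 by rewrite mulrC ler_pM2l// -div1r.
  move: sum_p; rewrite big_ord_recr/= -/L.
  exact: ar3 pN ta ra.
have L0 : 0 < L by apply: lt_trans La; rewrite divr_gt0.
(* positive probability provides points outside the null sets *)
have PA'0 : (0 < P A')%E by rewrite aE lte_fin.
have ae_exists (C : set W) (Q : W -> Prop) : measurable C -> (0 < P C)%E ->
    {ae P, forall w, Q w} -> exists2 w, C w & Q w.
  move=> mC PC [Z [mZ Z0 QZ]]; apply: contrapT => nex.
  have : (P C <= P Z)%E.
    apply: le_measure; rewrite ?inE// => w Cw; apply: QZ => /= Qw.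
    by apply: nex; exists w.
  by rewrite Z0 leNgt PC.
have [w0 A'w0 [cM nA1]] := ae_exists A' _ mA' PA'0 (filterI cvxM A1P).
have : forall k, exists x, (k < N)%N -> 0 < p k -> M w0 x /\ `|x - q k| < r.
  move=> k; have [kN|] := ltnP k N; last by exists 0.
  have [pk|] := ltP 0 (p k); last by exists 0.
  have [_ Aw AkP] := AP k.
  have mAk : measurable (A' `&` u @^-1` [set k]) by exact: measurableI.
  have Pk : (0 < P (A' `&` u @^-1` [set k]))%E.
    by rewrite -[X in (_ < X)%E]fineK ?fin_num_measure// lte_fin.
  have [w [A'w /= uw] [fMw Akw]] := ae_exists _ _ mAk Pk (filterI fM AkP).
  have Jw : J w = k.
    move: uw; rewrite /u /minn; case: ltnP => // _ Nk.
    by move: kN; rewrite -Nk ltnn.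
  have Akw' : A k w.
    by apply: Akw; [by apply: fMw; case: (A'0 w A'w)|rewrite -Jw; exact: JP].
  have [x Mx xq] := Aw w0 (bA' w w0 k A'w A'w0 kN Akw').
  by exists x.
move=> /choice[x xP].
have [_ nA1w0] := A'0 w0 A'w0.
apply: nA1w0; apply: nA1; exists (L^-1 *: \sum_(k < N) p k *: x k); split => /=.
  by apply: (@convex_set_sum _ _ (M w0) N p x) => // k kN pk; case: (xP k kN pk).
have -> : L^-1 *: (\sum_(k < N) p k *: x k) - e w0 =
    L^-1 *: (\sum_(k < N) p k *: (x k - q k)) +
    (L^-1 *: (\sum_(k < N) p k *: (q k - q i)) + (q i - e w0)).
  rewrite addrA -scalerDr -big_split/= addrA; congr (_ - _).
  rewrite -[X in _ + X](scale1r (q i)) -(mulVf (lt0r_neq0 L0)) -scalerA -scalerDr.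
  congr (_ *: _); rewrite scaler_suml -big_split/=; apply: eq_bigr => k _.
  by rewrite -scalerDr -scalerDr addrA subrK subrK.
have n1 : `|L^-1 *: (\sum_(k < N) p k *: (x k - q k))| <= r.
  rewrite normrZ ger0_norm; last by rewrite invr_ge0 ltW.
  rewrite ler_pdivrMl//.
  apply: le_trans (ler_norm_sum _ _ _) _; rewrite mulr_suml.
  apply: ler_sum => k _; rewrite normrZ ger0_norm//.
  have [pk|pk] := ltP 0 (p k); last first.
    have -> : p k = 0 by apply/eqP; rewrite eq_le pk p0.
    by rewrite !mul0r.
  by apply: ler_wpM2l => //; apply: ltW; case: (xP k (ltn_ord k) pk).
have n2 : `|L^-1 *: (\sum_(k < N) p k *: (q k - q i))| <= 6 * r.
  rewrite normrZ ger0_norm; last by rewrite invr_ge0 ltW.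
  rewrite ler_pdivrMl//.
  apply: le_trans d3 _.
  rewrite (_ : 3 * r * a = a / 2 * (6 * r)); last by field.
  by apply: ler_wpM2r; [rewrite mulr_ge0// ltW|exact: ltW].
have n3 : `|q i - e w0| < r by rewrite distrC -(IA' w0 A'w0).
apply: le_lt_trans (ler_normD _ _) _.
apply: le_lt_trans (lerD n1 (ler_normD _ _)) _.
exact: ar4 n2 n3 r0.
Qed.

End Jensen.

(** * Generalised conditional expectations *)

Section GenCondExpectation.
Context {d : measure_display} {W : measurableType d} {R : realType}
  {V : completeNormedModType R}.
Variables (P : probability W R) (H : set (set W)).
Hypotheses (sepV : separable_space V) (sH : sub_sigma_field H).
Local Notation TH := (g_sigma_algebraType H).

(** Closedness reduces membership to being near M within each 1/(n+1). *)
Lemma as_closed_approx (M : W -> set V) (e : W -> V) (B : set W) :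
  as_closed P M ->
  (forall n, {ae P, forall w, B w -> exists2 x, M w x & `|x - e w| < n.+1%:R^-1}) ->
  {ae P, forall w, B w -> M w (e w)}.
Proof.
move=> cM /ae_foralln near; have FF : Filter (almost_everywhere P) by exact: _.
apply: (filterS2 FF _ cM near) => w {}cM {}near Bw.
by apply: closed_approx => // n; exact: near.
Qed.

Lemma cond_expectation_in_convex (M : W -> set V) (f e : W -> V) (B : set W) :
  random_set H M -> as_closed P M -> as_convex P M ->
  is_cond_expectation P H f e -> H B ->
  {ae P, forall w, B w -> M w (f w)} -> {ae P, forall w, B w -> M w (e w)}.
Proof.
move=> rM clM cvxM ef HB fM; apply: as_closed_approx => // n.
have n0 : 0 < n.+1%:R^-1 :> R by rewrite invr_gt0.
have n1 : n.+1%:R^-1 <= 1 :> R by rewrite invf_le1// ler1n.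
have := cond_expectation_near sepV sH rM cvxM ef HB fM (r := n.+1%:R^-1 / 9).
rewrite [9 * _]mulrC divfK//; apply; first by rewrite divr_gt0.
have ar (x : R) : x <= 1 -> x / 9 <= 1 / 2 by lra.
exact: ar.
Qed.

Lemma series_partition (A : nat -> set W) (e : nat -> W -> V) w i :
  trivIset [set: nat] A -> A i w ->
  limn (series (fun j => restr (A j) (e j) w)) = e i w.
Proof.
move=> tA Aw; apply: cvg_lim => //; apply: (cvg_near_cst (e i w)).
exists i.+1 => // n /= ni; rewrite seriesEord/=.
rewrite (bigD1 (Ordinal ni))//= [X in X + _](_ : _ = e i w); last first.
  by rewrite /restr indicE mem_set// scale1r.
rewrite big1 ?addr0// => j ji; rewrite /restr indicE memNset ?scale0r// => Ajw.
move/eqP : ji; apply; apply: val_inj => /=.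
by apply: (tA _ _ I I); exists w.
Qed.

Lemma gen_cond_expectation_in_hull (X M : W -> set V) (z : W -> V) :
  random_set H M -> as_closed P M -> as_convex P M -> as_sub P X M ->
  gen_cond_expectations P X H z -> {ae P, forall w, M w (z w)}.
Proof.
move=> rM clM cvxM XM [xi [[_ xiX] _] [_ [A [e [[HA tA UA] ceA zE]]]]].
have FF : Filter (almost_everywhere P) by exact: _.
have eM : {ae P, forall w i, A i w -> M w (e i w)}.
  apply/ae_foralln => i.
  apply: (cond_expectation_in_convex rM clM cvxM (ceA i) (HA i)).
  apply: (filterS2 FF _ XM xiX) => w XMw Xw Aiw.
  by rewrite /restr indicE mem_set// scale1r; exact: XMw.
apply: (filterS2 FF _ eM zE) => w eMw ->.
have [i _ Aiw] : (\bigcup_i A i) w by rewrite UA.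
by rewrite (series_partition e tA Aiw); exact: eMw.
Qed.

(** An element of X that is H-measurable on A is unchanged there by conditional
    expectation.  It need not be integrable on A, hence the partition of A by
    the size of its norm. *)
Lemma gen_cond_expectation_glue (X : W -> set V) (A : set W) (zeta : W -> V) :
  L1H P X H !=set0 -> H A -> random_element H zeta ->
  {ae P, forall w, A w -> X w (zeta w)} ->
  exists2 z, gen_cond_expectations P X H z & forall w, A w -> z w = zeta w.
Proof.
move=> [xi0 [[rxi0 xi0X] [_ [A0 [HA0 tA0 UA0] ixi0]]]] HA rz zX.
have FF : Filter (almost_everywhere P) by exact: _.
have HT (B : set W) : H B -> measurable B by case: sH => _; apply.
have HTH (B : set W) : @measurable _ TH B -> H B by rewrite (sub_measurableE sH).
have THH (B : set W) : H B -> @measurable _ TH B by rewrite (sub_measurableE sH).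
have mz : borel_fun zeta by exact: (measurable_fun_sub sH rz).
have mxi0 : borel_fun xi0 by apply/random_element_measurableE.
pose xi w := if `[< A w >] then zeta w else xi0 w.
have mxi : borel_fun xi by apply: measurable_fun_if_set => //; exact: HT.
(* outside A the blocks of xi0, inside A the level sets of the norm of zeta *)
pose lev n := [set w | n%:R <= `|zeta w| < n.+1%:R].
pose C k := if odd k then A `&` lev k./2 else A0 k./2 `\` A.
have Hlev n : H (lev n).
  apply: HTH; rewrite (_ : lev n =
      (fun w : TH => `|zeta w|) @^-1` `[n%:R, n.+1%:R[%classic).
    rewrite -[X in measurable X]setTI; apply: (borel_fun_norm sepV rz) => //.
  by apply/seteqP; split=> w; rewrite /lev/= in_itv.
have HC k : H (C k).
  apply: HTH; rewrite /C; case: ifP => _.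
    by apply: measurableI; apply: THH.
  by apply: measurableD; apply: THH.
have tC : trivIset [set: nat] C.
  move=> i j _ _ [w [Ci Cj]]; rewrite -(odd_double_half i) -(odd_double_half j).
  move: Ci Cj; rewrite /C; case: (odd i); case: (odd j).
  - move=> [_ /andP[zi1 zi2]] [_ /andP[zj1 zj2]]; congr (_ + _.*2)%N.
    apply/eqP; rewrite eqn_leq; apply/andP.
    split; rewrite -ltnS -(ltr_nat R).
      exact: le_lt_trans zi1 zj2.
    exact: le_lt_trans zj1 zi2.
  - by move=> [Aw _] [_ nAw].
  - by move=> [_ nAw] [Aw _].
  - move=> [Ai _] [Aj _]; congr (_ + _.*2)%N.
    by apply: (tA0 _ _ I I); exists w.
have UC : \bigcup_i C i = [set: W].
  apply/seteqP; split=> // w _; have [Aw|nAw] := pselect (A w).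
    exists (Num.truncn `|zeta w|).*2.+1 => //.
    rewrite /C /= odd_double /= uphalf_double; split=> //.
    exact: truncn_itv.
  have [i _ Aiw] : (\bigcup_i A0 i) w by rewrite UA0.
  by exists i.*2 => //; rewrite /C odd_double doubleK.
have restrE k : restr (C k) xi = if odd k then restr (C k) zeta
    else restr (C k) (restr (A0 k./2) xi0).
  apply/funext => w; case: ifP => ok; rewrite /restr !indicE;
    case: (pselect (C k w)) => Cw; rewrite ?(mem_set Cw) ?(memNset Cw) ?scale0r//.
    by rewrite /xi asboolT//; move: Cw; rewrite /C ok => -[].
  move: Cw; rewrite /C ok => -[Aw nAw].
  by rewrite /xi asboolF// (mem_set Aw) !scale1r.
have irestr (B : set W) (h : W -> V) : measurable B -> bochner_integrable P h ->
    bochner_integrable P (restr B h).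
  move=> mB /(bochner_integrable_norm P sepV)[mh ih].
  have mrh : borel_fun (restr B h).
    rewrite (_ : restr B h = fun w => if `[< B w >] then h w else 0).
      by apply: measurable_fun_if_set => //; exact: measurable_cst.
    apply/funext => w; rewrite /restr indicE; case: asboolP => Bw.
      by rewrite mem_set// scale1r.
    by rewrite memNset// scale0r.
  apply/(bochner_integrable_norm P sepV); split=> //.
  apply: le_lt_trans ih; apply: ge0_le_integral => //.
  - exact/measurable_EFinP/borel_fun_norm.
  - exact/measurable_EFinP/borel_fun_norm.
  - move=> w _; rewrite lee_fin normrZ ler_piMl// indicE normr_nat.
    by case: (_ \in _).
have rrestr k : random_element H (restr (A `&` lev k) zeta).
  rewrite /random_element (_ : restr _ _ =
      fun w => if `[< (A `&` lev k) w >] then zeta w else 0).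
    apply: measurable_fun_if_set; [|exact: rz|exact: measurable_cst].
    by apply: measurableI; exact: THH.
  apply/funext => w; rewrite /restr indicE; case: asboolP => Bw.
    by rewrite mem_set// scale1r.
  by rewrite memNset// scale0r.
have ixi k : bochner_integrable P (restr (C k) xi).
  rewrite restrE; case: ifP => ok; last exact: irestr (HT _ (HC k)) (ixi0 _).
  have mrz : borel_fun (restr (C k) zeta).
    by rewrite /C ok; exact: (measurable_fun_sub sH (rrestr k./2)).
  apply/(bochner_integrable_norm P sepV); split=> //.
  apply: (@le_lt_trans _ _ (\int[P]_(w in [set: W]) (k./2.+1%:R)%:E)%E).
    apply: ge0_le_integral => //.
    - exact/measurable_EFinP/borel_fun_norm.
    - move=> w _; rewrite lee_fin /restr normrZ indicE normr_nat.
      have [Cw|nCw] := pselect (C k w); last by rewrite memNset// mul0r.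
      rewrite mem_set// mul1r; apply: ltW.
      by move: Cw; rewrite /C ok => -[_ /andP[]].
  rewrite integral_cst// [X in (_ * X)%E](_ : _ = 1%E) ?mule1 ?ltry//.
  exact: (probability_setT P).
(* on the odd blocks the restriction is H-measurable, and is taken as its own
   conditional expectation *)
have : forall k, exists e, is_cond_expectation P H (restr (C k) xi) e /\
    (odd k -> e = restr (C k) zeta).
  move=> k; have [e ek] := cond_expectation_exists sepV sH (ixi k).
  case ok : (odd k); last by exists e.
  exists (restr (C k) zeta); split=> //.
  have := restrE k; rewrite ok => E; rewrite -E.
  have [b1 b2 b3 b4] := ek; split=> //.
    by rewrite E /C ok.
  by move=> B HB; have [v v1 _] := b4 B HB; exists v.
move=> /choice[e eP].
have [kap [mkap kapP]] := measurable_first (fun k => THH _ (HC k)).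
pose z w := e (kap w) w.
have Ckap w : C (kap w) w.
  have [i _ Ciw] : (\bigcup_i C i) w by rewrite UC.
  by have [] := kapP w (ex_intro _ i Ciw).
exists z; last first.
  move=> w Aw; have := Ckap w; rewrite {1}/C /z; case: ifP => ok; last by case.
  move=> _; have [_ ->//] := eP (kap w).
  by rewrite /restr indicE mem_set ?scale1r//; exact: Ckap.
exists xi.
  split; last by split; [exact/random_element_measurableE|exists C].
  split; first exact/random_element_measurableE.
  apply: (filterS2 FF _ zX xi0X) => w zXw xi0Xw.
  by rewrite /xi; case: asboolP.
split.
  apply: (@measurable_fun_glue _ TH _ (borelType V) _ kap e) => // k.
  by have [[]] := eP k.
exists C, e; split=> //; first by move=> i; case: (eP i).
by apply: aeW => w; rewrite (series_partition e tC (Ckap w)).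
Qed.

(** If y w is at distance at least 1/(n+1) from M w, then it is that far from all
    the z k w, an event whose probability is at most every P [set w | 1/(n+1) <=
    `|z k w - y w|], hence zero. *)
Lemma cvg_in_probability_closed (M : W -> set V) (z : nat -> W -> V) (y : W -> V) :
  as_closed P M -> (forall n, borel_fun (z n)) -> borel_fun y ->
  (forall n, {ae P, forall w, M w (z n w)}) ->
  (forall eps : R, 0 < eps ->
    P [set w | eps <= `|z n w - y w|] @[n --> \oo] --> 0%E) ->
  {ae P, forall w, M w (y w)}.
Proof.
move=> clM mz my zM zy.
suff : {ae P, forall w, [set: W] w -> M w (y w)} by apply: filterS => w; exact.
apply: as_closed_approx => // n.
have n0 : 0 < n.+1%:R^-1 :> R by rewrite invr_gt0.
pose F k := [set w | n.+1%:R^-1 <= `|z k w - y w|].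
have mF k : measurable (F k).
  rewrite (_ : F k = ~` [set w | `|z k w - y w| < n.+1%:R^-1]).
    apply: measurableC; apply: measurable_lt_set; last exact: measurable_cst.
    exact: measurable_fun_dist.
  by apply/seteqP; split=> w; rewrite /F/= leNgt => /negP.
have PF0 : P (\bigcap_k F k) = 0%E.
  apply/eqP; rewrite eq_le measure_ge0 andbT.
  rewrite -(cvg_lim (@ereal_hausdorff R) (zy _ n0)); apply: lime_ge.
    by apply/cvg_ex; exists 0%E; exact: zy.
  apply: nearW => k; apply: le_measure; rewrite ?inE; last by move=> w; exact.
    exact: bigcapT_measurable.
  exact: mF.
have nF : {ae P, forall w, ~ (\bigcap_k F k) w}.
  exists (\bigcap_k F k); split=> //; first exact: bigcapT_measurable.
  by move=> w /= /contrapT.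
have FF : Filter (almost_everywhere P) by exact: _.
move/ae_foralln : zM => zM.
apply: (filterS2 FF _ nF zM) => w nFw zMw _.
apply: contrapT => nex; apply: nFw => k _.
rewrite /F/= leNgt; apply/negP => zk; apply: nex.
by exists (z k w).
Qed.

End GenCondExpectation.

Theorem proposition6p9 (R : realType) (V : completeNormedModType R)
    (d : measure_display) (W : measurableType d) (P : probability W R)
    (H : set (set W)) (X m E M : W -> set V) :
  separable_space V ->
  measure_is_complete P ->
  sub_sigma_field H ->
  random_set measurable X -> as_closed P X -> as_nonempty P X ->
  L1H P X H !=set0 ->
  is_cond_core P X H m ->
  is_set_gen_cond_expectation P X H E ->
  is_cond_hull P X H M ->
  {ae P, forall w, m w `<=` E w /\ E w `<=` M w}.
Proof.
move=> sepV _ sH _ _ _ XL [rm mX _] [rE clE LE] [rM clM cvxM XM _].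
have FF : Filter (almost_everywhere P) by exact: _.
have HT0 : H set0.
  by rewrite -(sub_measurableE sH).
have THH (B : set W) : H B -> @measurable _ (g_sigma_algebraType H) B.
  by rewrite (sub_measurableE sH).
have in_closure z : gen_cond_expectations P X H z ->
    closure_in_probability P H (gen_cond_expectations P X H) z.
  move=> zg; split; first by case: zg => xi _ [].
  exists (fun=> z); split=> // eps eps0.
  rewrite (_ : [set w | _] = set0) ?measure0; first exact: cvg_cst.
  by rewrite -subset0 => w /=; rewrite subrr normr0 leNgt eps0.
have nonex (D : W -> set V) (A : set W) (zeta : W -> V) :
    {ae P, forall w, (exists x, D w x) -> A w} -> {ae P, forall w, ~ A w} ->
    {ae P, forall w x, ~ D w x}.
  move=> DA nA; apply: (filterS2 FF _ DA nA) => w DAw nAw x Dx.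
  by apply: nAw; apply: DAw; exists x.
have mdiff (Y Z : W -> set V) : random_set H Y -> random_set H Z ->
    measurable ([set p | Y p.1 p.2 /\ ~ Z p.1 p.2] :
      set (g_sigma_algebraType H * borelType V)).
  move=> rY rZ; exact: measurableD rY rZ.
have mE : {ae P, forall w, m w `<=` E w}.
  have [A [zeta [HA rz zD AP]]] := random_set_selection P sepV sH (mdiff m E rm rE).
  have zX : {ae P, forall w, A w -> X w (zeta w)}.
    apply: (filterS _ mX) => w mXw Aw; apply: mXw.
    by have [] := zD w Aw.
  have [z zg zA] := gen_cond_expectation_glue sepV sH XL HA rz zX.
  have [_ zE] : L0 P E H z by rewrite LE; exact: in_closure.
  apply: (filterS2 FF _ AP zE) => w APw zEw x mx; apply: contrapT => nEx.
  have Aw : A w by apply: APw; exists x.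
  by have [_] := zD w Aw; rewrite /= -zA.
have EM : {ae P, forall w, E w `<=` M w}.
  have [A [zeta [HA rz zD AP]]] := random_set_selection P sepV sH (mdiff E M rE rM).
  have [z0 z0g _] : exists2 z, gen_cond_expectations P X H z &
      forall w, set0 w -> z w = 0.
    apply: (gen_cond_expectation_glue (zeta := fun=> 0) sepV sH XL HT0).
      exact: measurable_cst.
    by apply: aeW.
  have [rz0 z0E] : L0 P E H z0 by rewrite LE; exact: in_closure.
  pose y w := if `[< A w >] then zeta w else z0 w.
  have ry : random_element H y.
    by apply: measurable_fun_if_set => //; exact: THH.
  have yE : L0 P E H y.
    split=> //; apply: (filterS _ z0E) => w z0Ew; rewrite /y.
    by case: asboolP => // Aw; have [] := zD w Aw.
  have [_ [zn [zng zny]]] : closure_in_probability P H (gen_cond_expectations P X H) y.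
    by rewrite -LE.
  have mzn n : measurable_fun [set: W] (zn n : W -> borelType V).
    by have [xi _ [rzn _]] := zng n; exact: (measurable_fun_sub sH rzn).
  have yM : {ae P, forall w, M w (y w)}.
    apply: (cvg_in_probability_closed sepV clM mzn _ _ zny).
      exact: (measurable_fun_sub sH ry).
    by move=> n; exact: (gen_cond_expectation_in_hull sepV sH rM clM cvxM XM).
  apply: (filterS2 FF _ AP yM) => w APw yMw x Ex; apply: contrapT => nMx.
  have Aw : A w by apply: APw; exists x.
  have [_] := zD w Aw; apply.
  by move: yMw; rewrite /y asboolT.
by apply: (filterS2 FF _ mE EM).
Qed.
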